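(* Let $(R,\mathfrak m)$ be a two-dimensional regular local ring with maximal ideal $\mathfrak m$ and infinite residue field $R/\mathfrak m$, and let $x,y$ be a regular system of parameters for $R$. Let $$I=\langle x^{a_i}y^{b_i}\mid 0\le i\le r\rangle$$ be an $\mathfrak m$-primary complete (i.e. integrally closed) monomial ideal with respect to $x,y$, where $a_0>a_1>\dots>a_{r-1}>a_r=0$, $b_0=0<b_1<\dots<b_{r-1}<b_r$ and $a_0\le b_r$. Let $e$ be an integer with $2\le e\le r$ and $a_{r-e+2}=e-2$. Suppose that either (1) $r\ge e+1$, or (2) $r=e$, $x^{r-1}y\notin I$ and $x^r\in I$. Then there exists a finitely generated torsion-free indecomposable integrally closed $R$-module $M$ of rank $e$ with $I(M)=I$.
   Context: For a finitely generated torsion-free $R$-module $M$, let $M^{*}=\operatorname{Hom}_R(M,R)$. The double dual $F=M^{**}$ is a finitely generated free $R$-module canonically containing $M$, with $F/M$ of finite length. Define $I(M)=\operatorname{Fitt}_0(M^{**}/M)$ (the $0$th Fitting ideal). Integral closure of modules (Rees): let $K$ be the fraction field of $R$ and $M_K=M\otimes_R K$. For a ring $V$ with $R\subset V\subset K$ let $MV$ be the image of $M\otimes_R V\to M_K$. The integral closure of $M$ is $\overline M=\{f\in M_K\mid f\in MV$ for every discrete valuation ring $V$ with $R\subset V\subset K\}$, and $M$ is integrally closed if $\overline M=M$. *)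

(* Defs.v *)
From HB Require Import structures.
From mathcomp Require Import all_boot all_order all_algebra.
From mathcomp Require Import boolp classical_sets cardinality.
From mathcomp Require Import (canonicals) monalg.

Set Implicit Arguments.
Unset Strict Implicit.
Unset Printing Implicit Defensive.

Import Order.TTheory GRing.Theory Num.Theory.
Local Open Scope classical_set_scope.
Local Open Scope ring_scope.
Local Open Scope quotient_scope.

Section Span.
Context {R : pzRingType} {V : lmodType R}.

Definition submodule (N : set V) : Prop := submod_closed [in N].

(* Submodule generated by A *)
Definition span (A : set V) : set V := smallest submodule A.

Lemma span_submodule (A : set V) : submodule (span A).
Proof.
split=> [|a u v]; rewrite !inE.
  by move=> N [[N0 _] _]; rewrite inE in N0.
move=> Au Av N NA; have [[_ Nlin] _] := NA.
have := Nlin a u v; rewrite !inE; apply; [exact: Au | exact: Av].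
Qed.

Definition in_span (A : set V) : {pred V} := fun v => v \in span A.

Lemma in_span_zmod (A : set V) : zmod_closed (in_span A).
Proof.
exact: (GRing.submod_closedB (span_submodule A)).
Qed.

HB.instance Definition _ (A : set V) :=
  GRing.isZmodClosed.Build V (in_span A) (in_span_zmod A).

Lemma in_spanZ (A : set V) a v : v \in in_span A -> a *: v \in in_span A.
Proof.
move=> Av; case: (span_submodule A) => A0 Alin.
by rewrite -[a *: v]addr0; apply: Alin.
Qed.

End Span.

Section QuotientModule.
Context {R : pzRingType} {V : lmodType R}.
Variable A : set V.

(* V modulo the submodule generated by A *)
Definition quotmod : Type := Quotient.quot (in_span A).
HB.instance Definition _ := GRing.Zmodule.on quotmod.

Definition quot_proj (v : V) : quotmod := \pi_(Quotient.quot (in_span A)) v.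

Definition quotmod_scale (a : R) (q : quotmod) : quotmod :=
  quot_proj (a *: repr (q : Quotient.quot (in_span A))).

Lemma quot_projP (u v : V) :
  quot_proj u = quot_proj v <-> u - v \in in_span A.
Proof. by rewrite Quotient.idealrBE; split=> /eqP. Qed.

Lemma quot_projW (P : quotmod -> Prop) :
  (forall v, P (quot_proj v)) -> forall q, P q.
Proof. by move=> Pv; elim/quotW. Qed.

Lemma quot_projD (u v : V) : quot_proj (u + v) = quot_proj u + quot_proj v.
Proof. exact: Quotient.pi_add. Qed.

Lemma quot_projZ a (v : V) : quotmod_scale a (quot_proj v) = quot_proj (a *: v).
Proof.
apply/quot_projP; rewrite -scalerBr; apply: in_spanZ; apply/quot_projP.
exact: reprK.
Qed.

Let quotmod_scaleA a b q :
  quotmod_scale a (quotmod_scale b q) = quotmod_scale (a * b) q.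
Proof. by elim/quot_projW: q => v; rewrite !quot_projZ scalerA. Qed.

Let quotmod_scale1 : left_id 1 quotmod_scale.
Proof. by elim/quot_projW=> v; rewrite quot_projZ scale1r. Qed.

Let quotmod_scaleDr : right_distributive quotmod_scale +%R.
Proof.
move=> a; elim/quot_projW=> u; elim/quot_projW=> v.
by rewrite -quot_projD !quot_projZ scalerDr quot_projD.
Qed.

Let quotmod_scaleDl q : {morph quotmod_scale^~ q : a b / a + b}.
Proof.
move=> a b; elim/quot_projW: q => v.
by rewrite !quot_projZ scalerDl quot_projD.
Qed.

HB.instance Definition _ := GRing.Zmodule_isLmodule.Build R quotmod
  quotmod_scaleA quotmod_scale1 quotmod_scaleDr quotmod_scaleDl.

Lemma quot_proj_linear : linear quot_proj.
Proof. by move=> a u v; rewrite quot_projD -quot_projZ. Qed.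

HB.instance Definition _ :=
  GRing.isLinear.Build R V quotmod _ quot_proj quot_proj_linear.

End QuotientModule.

Section Ideals.
Context {R : comNzRingType}.
Implicit Types I J P Q : set R.

(* Unlike idealr_closed, this allows the unit ideal. *)
Definition ideal I : Prop := @submodule R R^o I.
Definition ideal_gen (A : set R) : set R := @span R R^o A.

Definition prime_ideal P : Prop :=
  idealr_closed [in P] /\ prime_idealr_closed [in P].

Definition maximal_ideal P : Prop :=
  idealr_closed [in P] /\
  forall J, idealr_closed [in J] -> P `<=` J -> J = P.

Definition radical I : set R := [set a | exists n, I (a ^+ n)].

Definition primary_ideal Q : Prop :=
  idealr_closed [in Q] /\ forall a b, Q (a * b) -> Q a \/ radical Q b.

Definition ideal_pow I n : set R :=
  ideal_gen [set \prod_(i < n) f i | f in [set f | forall i : 'I_n, I (f i)]].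

(* Equations of integral dependence
   z ^+ n + c 1 * z ^+ (n - 1) + ... + c n = 0 with c i in I ^ i *)
Definition ideal_closure I : set R :=
  [set z | exists n (c : nat -> R),
     (forall i, (0 < i <= n)%N -> ideal_pow I i (c i)) /\
     z ^+ n + \sum_(1 <= i < n.+1) c i * z ^+ (n - i) = 0].

Definition complete_ideal I : Prop := ideal_closure I = I.

Definition noetherian_ring : Prop :=
  forall I, ideal I -> exists s : seq R, I = ideal_gen [set` s].

Definition prime_chain n (P : nat -> set R) : Prop :=
  (forall i, (i <= n)%N -> prime_ideal (P i)) /\
  (forall i, (i < n)%N -> P i `<` P i.+1).

Definition has_krull_dim d : Prop :=
  (exists P : nat -> set R, prime_chain d P) /\
  (forall n (P : nat -> set R), prime_chain n P -> (n <= d)%N).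

End Ideals.
Arguments noetherian_ring : clear implicits.
Arguments has_krull_dim : clear implicits.

Definition local_ring (R : comNzRingType) (m : set R) : Prop :=
  maximal_ideal m /\ forall n, maximal_ideal n -> n = m.

Definition regular_local_ring (R : comNzRingType) (m : set R) (d : nat) :=
  [/\ noetherian_ring R, local_ring m, has_krull_dim R d
    & exists s : d.-tuple R, m = ideal_gen [set` s]].

(* The residue field, with the R-module structure only *)
Definition residue (R : comNzRingType) (m : set R) : Type :=
  @quotmod R R^o m.

Section Dual.
Context {R : comNzRingType} (M : lmodType R).

Definition dual : Type := {linear M -> R^o}.
Definition dual_fun (f : dual) : M -> R :=
  GRing.Linear.sort (f : {linear M -> R^o}).
Local Coercion dual_fun : dual >-> Funclass.

HB.instance Definition _ := gen_eqMixin dual.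
HB.instance Definition _ := gen_choiceMixin dual.

Lemma dualP (f g : dual) : f =1 g -> f = g.
Proof.
case: f g => [f [[f1] [f2]]] [g [[g1] [g2]]] /= /funext fg.
rewrite /dual_fun /= in fg; case: _ / fg g1 g2 => g1 g2.
by rewrite (Prop_irrelevance f1 g1) (Prop_irrelevance f2 g2).
Qed.

Definition dual_zero : dual := \0 : {linear M -> R^o}.
Definition dual_opp (f : dual) : dual :=
  \- (f : {linear M -> R^o}) : {linear M -> R^o}.
Definition dual_add (f g : dual) : dual :=
  (f : {linear M -> R^o}) \+ (g : {linear M -> R^o}) : {linear M -> R^o}.
Definition dual_scale (a : R) (f : dual) : dual :=
  a \*: (f : {linear M -> R^o}) : {linear M -> R^o}.

Let dual_addA : associative dual_add.
Proof. by move=> f g h; apply: dualP => u; apply: addrA. Qed.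
Let dual_addC : commutative dual_add.
Proof. by move=> f g; apply: dualP => u; apply: addrC. Qed.
Let dual_add0 : left_id dual_zero dual_add.
Proof. by move=> f; apply: dualP => u; apply: add0r. Qed.
Let dual_addN : left_inverse dual_zero dual_opp dual_add.
Proof. by move=> f; apply: dualP => u; apply: addNr. Qed.

HB.instance Definition _ :=
  GRing.isZmodule.Build dual dual_addA dual_addC dual_add0 dual_addN.

Let dual_scaleA a b f : dual_scale a (dual_scale b f) = dual_scale (a * b) f.
Proof. by apply: dualP => u; apply: mulrA. Qed.
Let dual_scale1 : left_id 1 dual_scale.
Proof. by move=> f; apply: dualP => u; apply: mul1r. Qed.
Let dual_scaleDr : right_distributive dual_scale +%R.
Proof. by move=> a f g; apply: dualP => u; apply: mulrDr. Qed.
Let dual_scaleDl f : {morph dual_scale^~ f : a b / a + b}.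
Proof. by move=> a b; apply: dualP => u; apply: mulrDl. Qed.

HB.instance Definition _ := GRing.Zmodule_isLmodule.Build R dual
  dual_scaleA dual_scale1 dual_scaleDr dual_scaleDl.

End Dual.
Coercion dual_fun : dual >-> Funclass.

Section Modules.
Context {R : comNzRingType}.

Definition eval_at (M : lmodType R) (u : M) : dual M -> R^o := fun f => f u.

Lemma eval_at_linear (M : lmodType R) (u : M) : linear (eval_at u).
Proof. by []. Qed.

HB.instance Definition _ (M : lmodType R) (u : M) :=
  GRing.isLinear.Build R (dual M) R^o _ (eval_at u) (eval_at_linear u).

(* The canonical map M -> M** *)
Definition bidual (M : lmodType R) (u : M) : dual (dual M) :=
  eval_at u : {linear dual M -> R^o}.

Definition finitely_generated (M : lmodType R) : Prop :=
  exists s : seq M, span [set` s] = [set: M].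

Definition torsion_free (M : lmodType R) : Prop :=
  forall (a : R) (u : M), a *: u = 0 -> a = 0 \/ u = 0.

Definition indecomposable (M : lmodType R) : Prop :=
  [set: M] <> [set 0] /\
  forall A B : set M, submodule A -> submodule B ->
    A `&` B = [set 0] -> span (A `|` B) = [set: M] ->
    A = [set 0] \/ B = [set 0].

(* Each row of T lists the coefficients of a relation between the g j; by
   Fitting's lemma the ideal does not depend on the finite generating
   family g, hence neither does the union over all of them. *)
Definition fitting0 (N : lmodType R) : set R :=
  [set c | exists k (g : 'I_k -> N), span (range g) = [set: N] /\
     ideal_gen [set \det T | T in
       [set T : 'M[R]_k | forall i, \sum_j T i j *: g j = 0]] c].

Definition ideal_of_module (M : lmodType R) : set R :=
  fitting0 (quotmod (range (@bidual M))).

End Modules.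

Section ScalarExtension.
Context {R : idomainType} (M : lmodType R).
Local Notation K := {fraction R}.

(* The free K-vector space on the set M, on which << u >> is the basis vector
   of u : M, modulo the relations that make u |-> << u >> R-linear *)
Local Notation "<< u >>" := (@monalg.mkmalgU M K u 1).
Local Notation free_on := (@monalg.malg M K).

Definition base_change_relations : set free_on :=
  [set w | exists (a : R) (u v : M),
     w = << a *: u + v >> - (tofrac a *: << u >> + << v >>)].

(* M_K, the tensor product of M and K over R, as a K-vector space *)
Definition base_change : Type := quotmod base_change_relations.
HB.instance Definition _ := GRing.Lmodule.on base_change.

(* u |-> u (x) 1 *)
Definition to_base_change (u : M) : base_change :=
  quot_proj base_change_relations << u >>.

Definition has_rank (e : nat) : Prop :=
  exists b : 'I_e -> base_change,
    forall w, exists! c : {ffun 'I_e -> K}, w = \sum_i c i *: b i.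

(* MV, the image in M_K of the tensor product of M and V over R *)
Definition extension (V : set K) : set base_change :=
  [set w | exists n (c : 'I_n -> K) (u : 'I_n -> M),
     (forall i, V (c i)) /\ w = \sum_i c i *: to_base_change (u i)].

End ScalarExtension.

(* A normalized discrete valuation; the value at 0 is irrelevant. *)
Definition discrete_valuation (K : fieldType) (v : K -> int) : Prop :=
  [/\ forall a b, a != 0 -> b != 0 -> v (a * b) = v a + v b,
      forall a b, a != 0 -> b != 0 -> a + b != 0 ->
        Num.min (v a) (v b) <= v (a + b)
    & forall n : int, exists2 a, a != 0 & v a = n].

(* A discrete valuation ring with fraction field K; a discrete valuation ring
   between R and K = Frac R has fraction field K. *)
Definition dvr_of (K : fieldType) (V : set K) : Prop :=
  exists2 v, discrete_valuation v & V = [set a | a = 0 \/ 0 <= v a].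

Definition integral_closure (R : idomainType) (M : lmodType R) :
    set (base_change M) :=
  [set f | forall V : set {fraction R},
     dvr_of V -> range (@tofrac R) `<=` V -> extension V f].

Definition integrally_closed (R : idomainType) (M : lmodType R) : Prop :=
  @integral_closure R M = range (@to_base_change R M).

(* Main.v *)
From HB Require Import structures.
Require Import Defs.
From mathcomp Require Import all_boot all_order all_algebra fingroup perm.
From mathcomp Require Import boolp classical_sets cardinality.
From mathcomp Require Import ring lra zify.
From mathcomp Require Import (canonicals) monalg.

Set Implicit Arguments.
Unset Strict Implicit.
Unset Printing Implicit Defensive.

Import Order.TTheory GRing.Theory Num.Theory.
Local Open Scope classical_set_scope.
Local Open Scope ring_scope.

(** The module is the integral closure in R^e of the row space of an explicit
matrix [generators].  Its rows are the e-1 rows x e_j + y e_(j+1) of a band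
and, for each monomial generator x^(a_i) y^(b_i) of I, one row with a single
entry: in the column c = [gen_col i], that monomial divided by
x^c y^(e-1-c).  The condition on the exponents a_i is what makes all these
divisions possible.

Maximal minors.  The determinant of the band completed by a row v is, up to
sign, the alternating sum of x^k y^(e-1-k) v_k, so completing by the single
entry rows gives back exactly the generators of I ([ideal_gen_minors]).  A
minor using several single entry rows also lies in I, and so does each term of
its Leibniz expansion: reading the factors from the left column to the right
one, the exponents never fall too far below the staircase of I
([gen_product], [generators_minor]).  So the ideal of maximal minors is I.

Valuations.  For z outside the complete ideal I there is a discrete valuation
v with v(z) < v(I) ([valuative_criterion]): I is an intersection of ideals
(x^s, y^t), completeness says that the exponents of I are the lattice points
of a convex region, and a line separating a corner monomial from this region
defines a monomial valuation.  Consequently, passing from the rows to their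
integral closure M keeps all maximal minors inside I ([closure_rows_det]).
The ring R is the intersection of the discrete valuation rings between R and
its fraction field ([fraction_in_all_dvr]), so the integral closure computed
in K^e lies in R^e and M is integrally closed
([closure_rows_integrally_closed]).

Fitting ideal.  M contains x^A R^e and y^B R^e for some A and B, and x^A, y^B
is a regular sequence; hence every functional on M extends to R^e, the double
dual of M is R^e, and the Fitting ideal of R^e/M is generated by the maximal
minors of M ([ideal_of_submod]).

Indecomposability.  A splitting of M is given by an idempotent matrix E over
R that maps M to itself.  If u is a row of the band, then u E is in M, so the
band completed by u E has determinant in I.  This determinant is a form of
degree e in x and y whose coefficients are entries of E or differences of two of
them, while
I is contained in (x^e) + m^(e+1): modulo m, the matrix E is triangular and
constant along its diagonals ([band_endomorphism]).  Such an idempotent is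
0 or 1 ([triangular_idempotent]).

The facts on R itself come from its two generators: Krull's principal ideal
theorem for x ([y_not_nilpotent_mod_x]) shows that x generates a prime ideal
not containing y, and the other properties of R used here follow from this. *)

(** * Ideals and determinants *)

Section IdealTools.
Context {R : comNzRingType}.
Implicit Types (I J A : set R) (c z : R).

Lemma idealP I : ideal I <->
  [/\ I 0, forall u v, I u -> I v -> I (u + v) & forall a u, I u -> I (a * u)].
Proof.
split=> [[I0 Ilin]|[I0 ID IM]].
  have {}I0 : I 0 by move: I0; rewrite inE.
  have {}Ilin a u v : I u -> I v -> I (a * u + v).
    by move=> Iu Iv; have := Ilin a u v; rewrite !inE; apply.
  split=> // [u v Iu Iv|a u Iu]; first by have := Ilin 1 u v Iu Iv; rewrite mul1r.
  by have := Ilin a u 0 Iu I0; rewrite addr0.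
split; first by rewrite inE.
move=> a u v; rewrite !inE => Iu Iv; apply: ID => //; exact: IM.
Qed.

Section Closure.
Variable I : set R.
Hypothesis idI : ideal I.
Lemma ideal0 : I 0. Proof. by case/idealP: idI. Qed.
Lemma idealD u v : I u -> I v -> I (u + v).
Proof. by case/idealP: idI => _ + _; apply. Qed.
Lemma idealMl a u : I u -> I (a * u).
Proof. by case/idealP: idI => _ _; apply. Qed.
Lemma idealMr a u : I u -> I (u * a).
Proof. by rewrite mulrC; apply: idealMl. Qed.
Lemma idealN u : I u -> I (- u).
Proof. by rewrite -mulN1r; apply: idealMl. Qed.
Lemma idealB u v : I u -> I v -> I (u - v).
Proof. by move=> Iu /idealN; apply: idealD. Qed.
Lemma ideal_subl u v : I v -> I (u - v) -> I u.
Proof. by move=> Iv /(idealD Iv); rewrite addrC subrK. Qed.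
Lemma ideal_sum (T : Type) (r : seq T) (P : pred T) (F : T -> R) :
  (forall i, P i -> I (F i)) -> I (\sum_(i <- r | P i) F i).
Proof. by move=> IF; elim/big_rec: _ => [|i u Pi]; [apply: ideal0 | apply: idealD;
  apply: IF]. Qed.
End Closure.

Lemma idealr_closed_ideal I : idealr_closed [in I] -> ideal I.
Proof.
case=> I0 _ Ilin; split; first exact: I0.
by move=> a u v Iu Iv; apply: Ilin.
Qed.

Lemma idealr_closed_proper I : idealr_closed [in I] -> ~ I 1.
Proof. by case=> _ /negP n1 _ I1; apply: n1; rewrite inE. Qed.

Lemma proper_idealr_closed I : ideal I -> ~ I 1 -> idealr_closed [in I].
Proof.
move=> idI n1; split; first by rewrite inE; apply: ideal0.
  by apply/negP; rewrite inE.
by move=> a u v; rewrite !inE => Iu Iv; apply: idealD => //; apply: idealMl.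
Qed.

Definition multiples c : set R := [set z | exists t, z = t * c].
Definition ideal_add I J : set R := [set z | exists u v, [/\ I u, J v & z = u + v]].

Lemma multiples_ideal c : ideal (multiples c).
Proof.
apply/idealP; split; first by exists 0; rewrite mul0r.
  by move=> _ _ [s ->] [t ->]; exists (s + t); rewrite mulrDl.
by move=> a _ [t ->]; exists (a * t); rewrite mulrA.
Qed.

Lemma multiples_id c : multiples c c. Proof. by exists 1; rewrite mul1r. Qed.

Lemma multiples_sub c I : ideal I -> I c -> multiples c `<=` I.
Proof. by move=> idI Ic _ [t ->]; apply: idealMl. Qed.

Lemma ideal_add_ideal I J : ideal I -> ideal J -> ideal (ideal_add I J).
Proof.
move=> idI idJ; apply/idealP; split.
- by exists 0, 0; split; rewrite ?addr0 //; apply: ideal0.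
- move=> _ _ [u [v [Iu Jv ->]]] [u' [v' [Iu' Jv' ->]]].
  by exists (u + u'), (v + v'); split; rewrite 1?addrACA //; apply: idealD.
- move=> a _ [u [v [Iu Jv ->]]].
  by exists (a * u), (a * v); split; rewrite ?mulrDr //; apply: idealMl.
Qed.

Lemma ideal_add_l I J : ideal J -> I `<=` ideal_add I J.
Proof. by move=> idJ u Iu; exists u, 0; split; rewrite ?addr0 //; apply: ideal0. Qed.
Lemma ideal_add_r I J : ideal I -> J `<=` ideal_add I J.
Proof. by move=> idI u Ju; exists 0, u; split; rewrite ?add0r //; apply: ideal0. Qed.
Lemma ideal_add_sub I J A : ideal A -> I `<=` A -> J `<=` A -> ideal_add I J `<=` A.
Proof. by move=> idA IA JA _ [u [v [/IA Iu /JA Jv ->]]]; apply: idealD. Qed.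

Lemma ideal_gen_ideal (A : set R) : ideal (ideal_gen A).
Proof. exact: (@span_submodule R R^o). Qed.
Lemma ideal_gen_sub (A : set R) : A `<=` ideal_gen A.
Proof. by move=> u Au; apply: sub_gen_smallest. Qed.
Lemma ideal_gen_min (A J : set R) : ideal J -> A `<=` J -> ideal_gen A `<=` J.
Proof. by move=> idJ AJ; apply: smallest_sub. Qed.
Lemma ideal_gen_mono (A B : set R) : A `<=` B -> ideal_gen A `<=` ideal_gen B.
Proof.
by move=> AB; apply: ideal_gen_min; [apply: ideal_gen_ideal|move=> u /AB;
  apply: ideal_gen_sub].
Qed.

Lemma ideal_gen_pair a b : ideal_gen [set a; b] = ideal_add (multiples a) (multiples b).
Proof.
apply/seteqP; split.
  apply: ideal_gen_min; first by apply: ideal_add_ideal; apply: multiples_ideal.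
  move=> _ [|] ->.
    by apply: ideal_add_l; [apply: multiples_ideal|apply: multiples_id].
  by apply: ideal_add_r; [apply: multiples_ideal|apply: multiples_id].
apply: ideal_add_sub; first exact: ideal_gen_ideal.
  by apply: multiples_sub; [apply: ideal_gen_ideal|apply: ideal_gen_sub; left].
by apply: multiples_sub; [apply: ideal_gen_ideal|apply: ideal_gen_sub; right].
Qed.

Lemma ideal_gen_seq (s : seq R) z :
  ideal_gen [set` s] z -> exists c : 'I_(size s) -> R, z = \sum_i c i * s`_i.
Proof.
pose J := [set w | exists c : 'I_(size s) -> R, w = \sum_i c i * s`_i].
have idJ : ideal J.
  apply/idealP; split.
  - by exists (fun=> 0); rewrite big1 // => i _; rewrite mul0r.
  - move=> _ _ [c ->] [d ->]; exists (fun i => c i + d i).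
    by rewrite -big_split; apply: eq_bigr => i _; rewrite mulrDl.
  - move=> a _ [c ->]; exists (fun i => a * c i).
    by rewrite mulr_sumr; apply: eq_bigr => i _; rewrite mulrA.
suff sJ : [set` s] `<=` J by move/(ideal_gen_min idJ sJ).
move=> w /= sw; have wi : (index w s < size s)%N by rewrite index_mem.
exists (fun i => (i == Ordinal wi)%:R).
rewrite (bigD1 (Ordinal wi)) //= eqxx mul1r nth_index // big1 ?addr0 //.
by move=> i /negPf ->; rewrite mul0r.
Qed.

Lemma prod_sub1_cong I (T : Type) (r : seq T) (F : T -> R) :
  ideal I -> (forall i, I (F i)) -> I (1 - \prod_(i <- r) (1 - F i)).
Proof.
move=> idI IF; elim/big_rec: _ => [|i u _ Iu]; first by rewrite subrr; apply: ideal0.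
have -> : 1 - (1 - F i) * u = (1 - u) + u * F i by ring.
by apply: idealD => //; apply: idealMl.
Qed.

(** Every permutation but the identity moves some i to a larger index, so its
term in the Leibniz expansion has a factor in I. *)
Lemma det_sub1_cong I n (E : 'M[R]_n) : ideal I ->
  (forall i j : 'I_n, (i <= j)%N -> I (E i j)) -> I (1 - \det (1%:M - E)).
Proof.
move=> idI IE; rewrite /determinant (bigD1 (1%g : 'S_n)) //= odd_perm1 expr0 mul1r opprD
  addrA.
apply: idealB => //.
  under eq_bigr => i _ do rewrite !mxE perm1 eqxx.
  by apply: prod_sub1_cong => // i; apply: IE.
apply: ideal_sum => // s s1.
have [i lt_i] : exists i : 'I_n, (i < s i)%N.
  apply: contrapT => noti; case/eqP: s1; apply/permP => i; rewrite perm1.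
  have le_s j : (s j <= j)%N by rewrite leqNgt; apply/negP => ltj; apply: noti; exists j.
  have [k] := ubnP (i : nat); elim: k i => // k IHk i ltik.
  have := le_s i; rewrite leq_eqVlt => /orP[/eqP eqi|lti]; first exact/val_inj.
  have /perm_inj ski : s (s i) = s i by apply: IHk; apply: (leq_trans lti).
  by rewrite ski ltnn in lti.
apply: idealMl => //; rewrite (bigD1 i) //=; apply: idealMr => //.
have /negPf neq_i : i != s i by apply: contraTneq lt_i => <-; rewrite ltnn.
rewrite !mxE neq_i sub0r.
by apply: idealN => //; apply: IE; apply: ltnW.
Qed.

End IdealTools.

(** * Noetherian local rings *)

Section Noetherian.
Context {R : comNzRingType}.
Hypothesis noethR : noetherian_ring R.

(** The empty set is added to S to give Zorn's lemma an upper bound for the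
empty chain; a union of a nonempty chain is finitely generated, hence is one
of its members. *)
Lemma noetherian_max (S : set (set R)) J0 : S J0 -> (forall J, S J -> ideal J) ->
  exists2 J, S J & forall J', S J' -> J `<=` J' -> J' `<=` J.
Proof.
move=> SJ0 idS.
have [|A [[SA|A0] Amax]] := @Zorn_bigcup R [set J | S J \/ J = set0].
- move=> F FS Ftot.
  have [[J1 FJ1 SJ1]|Fn] := pselect (exists2 J, F J & S J); last first.
    right; apply/seteqP; split=> // z [J FJ Jz].
    by have [SJ|J0'] := FS J FJ; [case: Fn; exists J | rewrite J0' in Jz].
  have [|s defU] := noethR (I := \bigcup_(X in F) X).
    apply/idealP; split.
    - by exists J1 => //; apply: ideal0; apply: idS.
    - move=> u v [J FJ Ju] [J' FJ' Jv].
      have SJ : S J by case: (FS J FJ) => // J0'; rewrite J0' in Ju.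
      have SJ' : S J' by case: (FS J' FJ') => // J0'; rewrite J0' in Jv.
      case: (Ftot J J' FJ FJ') => sub.
        by exists J' => //; apply: idealD; [apply: idS|apply: sub|].
      by exists J => //; apply: idealD; [apply: idS| |apply: sub].
    - move=> a u [J FJ Ju]; exists J => //.
      by apply: idealMl => //; apply: idS; case: (FS J FJ) => // J0'; rewrite J0' in Ju.
  have [J FJ [SJ sJ]] : exists2 J, F J & S J /\ [set` s] `<=` J.
    have : [set` s] `<=` \bigcup_(X in F) X by rewrite defU; apply: ideal_gen_sub.
    elim: (s) => [|c s' IHs] ss; first by exists J1 => //; split.
    have [|J FJ [SJ sJ]] := IHs; first by move=> u /= us; apply: ss; rewrite /= inE us orbT.
    have [|J' FJ' Jc] := ss c; first by rewrite /= inE eqxx.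
    have SJ' : S J' by case: (FS J' FJ') => // J0'; rewrite J0' in Jc.
    case: (Ftot J J' FJ FJ') => sub.
      by exists J' => //; split=> // u /=; rewrite inE => /orP[/eqP -> //|us]; apply/sub/sJ.
    by exists J => //; split=> // u /=; rewrite inE => /orP[/eqP ->|us];
      [apply: sub|apply/sJ].
  left; suff -> : \bigcup_(X in F) X = J by [].
  apply/seteqP; split; last by move=> u Ju; exists J.
  by rewrite defU; apply: ideal_gen_min sJ; apply: idS.
- exists A => // J SJ AJ; apply: contrapT => nJA.
  by apply: (Amax J); [split | left].
- case: (Amax J0); last by left.
  rewrite A0; split=> // sub0; exact: sub0 (ideal0 (idS _ SJ0)).
Qed.

Lemma noetherian_chain (J : nat -> set R) : (forall n, ideal (J n)) ->
  (forall n, J n `<=` J n.+1) -> exists n, J n.+1 `<=` J n.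
Proof.
move=> idJ incJ.
have [||_ [n _ <-] Jmax] := @noetherian_max (range J) (J 0%N).
- by exists 0%N.
- by move=> _ [n _ <-].
by exists n; apply: Jmax => //; exists n.+1.
Qed.

Lemma noetherian_maximal_ideal (J : set R) : ideal J -> ~ J 1 ->
  exists2 P, maximal_ideal P & J `<=` P.
Proof.
move=> idJ J1.
have [||P [idP P1 JP] Pmax] :=
   @noetherian_max [set P : set R | [/\ ideal P, ~ P 1 & J `<=` P]] J.
- by split.
- by move=> ? [].
exists P => //; split; first exact: proper_idealr_closed.
move=> Q Qid PQ; apply/seteqP; split => //; apply: Pmax => //; split.
- exact: idealr_closed_ideal.
- exact: idealr_closed_proper.
- exact: subset_trans PQ.
Qed.

End Noetherian.

Section PrimeIdeals.
Context {R : comNzRingType} (P : set R) (primeP : prime_ideal P).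

Lemma prime_ideal_ideal : ideal P.
Proof. by case: primeP => /idealr_closed_ideal. Qed.
Lemma prime_ideal1 : ~ P 1.
Proof. by case: primeP => /idealr_closed_proper. Qed.
Lemma prime_idealM u v : P (u * v) -> P u \/ P v.
Proof.
case: primeP => _ primeP' Puv; have := primeP' u v.
by rewrite !inE => /(_ Puv) /orP[] /set_mem; [left | right].
Qed.
Lemma prime_idealX u n : P (u ^+ n) -> P u.
Proof.
elim: n => [|n IHn]; first by rewrite expr0 => /prime_ideal1.
by rewrite exprS => /prime_idealM[].
Qed.
Lemma not_primeM u v : ~ P u -> ~ P v -> ~ P (u * v).
Proof. by move=> Pu Pv /prime_idealM[]. Qed.
End PrimeIdeals.

Lemma mk_prime_ideal (R : comNzRingType) (P : set R) : ideal P -> ~ P 1 ->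
  (forall u v, P (u * v) -> P u \/ P v) -> prime_ideal P.
Proof.
move=> idP P1 PM; split; first exact: proper_idealr_closed.
by move=> u v; rewrite !inE => /PM [] Pu; apply/orP; [left|right]; rewrite inE.
Qed.

Section LocalRing.
Context {R : idomainType} (m : set R).
Hypothesis noethR : noetherian_ring R.
Hypothesis local : local_ring m.

Lemma local_ideal : ideal m.
Proof. by case: local => [[/idealr_closed_ideal]]. Qed.
Lemma local_proper : ~ m 1.
Proof. by case: local => [[/idealr_closed_proper]]. Qed.

Lemma proper_sub_local J : ideal J -> ~ J 1 -> J `<=` m.
Proof.
move=> idJ J1; have [P maxP JP] := noetherian_maximal_ideal noethR idJ J1.
by case: local => _ /(_ P maxP) <-.
Qed.

Lemma local_unit u : ~ m u -> u \is a GRing.unit.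
Proof.
move=> mu; apply: contrapT => nu; apply: mu.
apply: (proper_sub_local (multiples_ideal u)); last exact: multiples_id.
by case=> t t1; apply: nu; apply/unitrPr; exists t; rewrite mulrC.
Qed.

Lemma unit_not_local u : u \is a GRing.unit -> ~ m u.
Proof.
move=> /mulrV u1 mu; apply: local_proper; rewrite -u1.
exact: (idealMr local_ideal _ mu).
Qed.

Lemma local_sub1 u : m u -> 1 - u \is a GRing.unit.
Proof.
move=> mu; apply: local_unit => m1u; apply: local_proper.
by have := idealD local_ideal m1u mu; rewrite subrK.
Qed.

Lemma local_prime : prime_ideal m.
Proof.
apply: mk_prime_ideal; [exact: local_ideal | exact: local_proper |].
move=> u v muv; apply: contrapT => /not_orP[/local_unit u1 /local_unit v1].
by apply: unit_not_local muv; rewrite unitrM u1.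
Qed.

Lemma ideal_unitM (J : set R) u v : ideal J -> u \is a GRing.unit -> J (u * v) -> J v.
Proof. by move=> idJ u1 /(idealMl idJ u^-1); rewrite mulKr. Qed.

(** Writing the equations g_i = a_i + z (combination of the g_j) for generators
g_i of J, the matrix of the system has determinant 1 modulo m. *)
Lemma nakayama (A J : set R) z : ideal A -> ideal J -> m z ->
  (forall g, J g -> exists a t, [/\ A a, J t & g = a + z * t]) -> J `<=` A.
Proof.
move=> idA idJ mz JAz; have [s defJ] := noethR idJ.
have Js (i : 'I_(size s)) : J s`_i by rewrite defJ; apply: ideal_gen_sub; apply: mem_nth.
have /choice[a0 /choice[c Hac]] (i : 'I_(size s)) : exists a, exists c : 'I_(size s) -> R,
    A a /\ s`_i = a + z * \sum_j c j * s`_j.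
  have [a [t [Aa]]] := JAz _ (Js i); rewrite {1}defJ => /ideal_gen_seq[c ->] ->.
  by exists a, c.
pose C := \matrix_(i, j) (z * c i j); pose v : 'cV[R]_(size s) := \col_i s`_i.
have unitC : \det (1%:M - C) \is a GRing.unit.
  rewrite -[\det _](subKr 1); apply: local_sub1;
    apply: det_sub1_cong local_ideal _ => i j _.
  by rewrite mxE; apply: (idealMr local_ideal _ mz).
have Cv : (1%:M - C) *m v = \col_i a0 i.
  apply/colP => i; rewrite mulmxBl mul1mx !mxE (proj2 (Hac i)) mulr_sumr.
  apply/eqP; rewrite subr_eq; apply/eqP; congr (_ + _).
  by apply: eq_bigr => j _; rewrite !mxE mulrA.
have As (i : 'I_(size s)) : A s`_i.
  apply: (ideal_unitM idA unitC).
  have -> : \det (1%:M - C) * s`_i = (\adj (1%:M - C) *m (\col_i a0 i)) i 0.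
    by rewrite -Cv mulmxA mul_adj_mx mul_scalar_mx !mxE.
  rewrite mxE; apply: ideal_sum => // j _; rewrite !mxE; apply: idealMl => //.
  by case: (Hac j).
rewrite defJ; apply: ideal_gen_min => // u /= us.
have ui : (index u s < size s)%N by rewrite index_mem.
by have := As (Ordinal ui); rewrite /= nth_index.
Qed.

(** If g could be divided by z forever modulo A, the successive quotients h_n
would generate with A an increasing chain of ideals; where it stops,
h_(n+1) is a multiple of z h_(n+1) modulo A, hence lies in A. *)
Lemma exact_power (A : set R) z g : ideal A -> m z -> (forall w, A (z * w) -> A w) ->
  ~ A g -> exists i h, A (g - z ^+ i * h) /\ ~ ideal_add A (multiples z) h.
Proof.
move=> idA mz regz Ag; apply: contrapT => nex.
have step i h : A (g - z ^+ i * h) -> exists h', A (h - z * h').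
  move=> Agh; apply: contrapT => nh; apply: nex; exists i, h;
    split=> // -[a [_ [Aa [t ->] hE]]].
  by apply: nh; exists t; rewrite hE [z * _]mulrC addrK.
have next (p : nat * R) : exists h', A (g - z ^+ p.1 * p.2) -> A (p.2 - z * h').
  have [/step[h' ?]|] := pselect (A (g - z ^+ p.1 * p.2)); first by exists h'.
  by exists 0.
have /choice[f Hf] := next.
(* the successive quotients of g by z modulo A *)
pose h := fix h n := if n is n'.+1 then f (n', h n') else g.
have hA n : A (g - z ^+ n * h n).
  elim: n => [|n IHn]; first by rewrite expr0 mul1r subrr; apply: ideal0.
  have := Hf (n, h n) IHn; rewrite /= => /(idealMl idA (z ^+ n)) /(idealD idA IHn).
  by rewrite mulrBr mulrA -exprSr addrA subrK.
have hS n : A (h n - z * h n.+1) by apply: (Hf (n, h n)); apply: hA.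
pose J n := ideal_add A (multiples (h n)).
have idJ n : ideal (J n) by apply: ideal_add_ideal => //; apply: multiples_ideal.
have Jh n : J n (h n) by apply: ideal_add_r (multiples_id _).
have [|n Jn] := noetherian_chain noethR idJ.
  move=> n; apply: ideal_add_sub => //; first exact: ideal_add_l (multiples_ideal _).
  apply: multiples_sub => //; rewrite -[h n](subrK (z * h n.+1)).
  apply: idealD => //; first exact: ideal_add_l (multiples_ideal _) _ (hS n).
  exact: idealMl.
have [a [_ [Aa [c ->] hE]]] := Jn _ (Jh n.+1).
have Ah : A (h n.+1).
  apply: (@ideal_unitM A (1 - c * z)) => //.
    by apply: local_sub1; apply: (idealMl local_ideal _ mz).
  have -> : (1 - c * z) * h n.+1 = (h n.+1 - c * h n) + c * (h n - z * h n.+1) by ring.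
  by apply: idealD => //; [rewrite {1}hE addrK | apply: idealMl].
apply: Ag; have := hA n.+1; apply: ideal_subl => //; exact: idealMl.
Qed.

End LocalRing.

(** * Parameters in dimension two *)

Section TwoGenerators.
Context {R : idomainType} (m : set R).
Hypothesis noethR : noetherian_ring R.
Hypothesis local : local_ring m.

Section Pair.
Variables x y : R.
Hypothesis mxy : m = ideal_gen [set x; y].

Lemma mem_mx : m x. Proof. by rewrite mxy; apply: ideal_gen_sub; left. Qed.
Lemma mem_my : m y. Proof. by rewrite mxy; apply: ideal_gen_sub; right. Qed.

Lemma mem_local u : m u -> exists a b, u = a * x + b * y.
Proof. by rewrite mxy ideal_gen_pair => -[_ [_ [[a ->] [b ->] ->]]]; exists a, b. Qed.

(** Modulo x the maximal ideal is generated by y, so up to units the elements of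
R/(x) are powers of y. *)
Lemma power_mod_x g i : ideal_add (multiples x) (multiples (y ^+ i)) g \/
  exists j u, [/\ (j < i)%N, u \is a GRing.unit & multiples x (g - u * y ^+ j)].
Proof.
elim: i => [|i [[_ [_ [[a ->] [b ->] ->]]]|[j [u [ji u1 xg]]]]].
- by left; exists 0, g; split; [exists 0; rewrite mul0r|exists g;
  rewrite expr0 mulr1|rewrite add0r].
- have [/mem_local[c [d ->]]|/(local_unit noethR local) b1] := pselect (m b).
    left; exists ((a + c * y ^+ i) * x), (d * y ^+ i.+1).
    by split; [exists (a + c * y ^+ i)|exists d|rewrite exprS; ring].
  by right; exists i, b; split=> //; exists a; rewrite addrK.
- by right; exists j, u; split=> //; apply: ltnW.
Qed.

(** Otherwise R/(x) has finitely many ideals.  If P is a prime with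
0 < P < m and f a nonzero element of P, the symbolic powers Q_k of (f) along P
decrease, so that two consecutive ones have the same image in R/(x).  As x is
not in P, Nakayama's lemma then gives Q_k = Q_(k+1), hence s f^k = t f^(k+1) for
some s outside P, whereas s = t f lies in P. *)
Lemma y_not_nilpotent_mod_x n : has_krull_dim R 2 -> ~ multiples x (y ^+ n).
Proof.
move=> [[P [primeP incP]] _] xyn.
have primeP1 := primeP 1%N isT; have idP := prime_ideal_ideal primeP1.
have [P01 [f [Pf P0f]]] : P 0%N `<=` P 1%N /\ exists f, P 1%N f /\ ~ P 0%N f.
  by case: (incP 0%N isT) => ? /existsNP[f /not_implyP]; split=> //; exists f.
have f0 : f != 0.
  by apply/eqP => f0; apply: P0f; rewrite f0; apply: ideal0;
    exact: prime_ideal_ideal (primeP 0%N isT).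
have [P12 [g [P2g P1g]]] : P 1%N `<=` P 2%N /\ exists g, P 2%N g /\ ~ P 1%N g.
  by case: (incP 1%N isT) => ? /existsNP[g /not_implyP]; split=> //; exists g.
have mg : m g.
  have prime2 := primeP 2%N isT.
  by apply: (proper_sub_local noethR local) P2g;
    [apply: prime_ideal_ideal|apply: prime_ideal1].
move: (P 1%N) P1g Pf {P01 P0f P12 P2g primeP incP} primeP1 idP => {}P Pg Pf primeP1 idP.
have Px : ~ P x.
  move=> Px; apply: Pg; have [a [b ->]] := mem_local mg.
  apply: idealD; rewrite //; apply: idealMl => //.
  by apply: (prime_idealX primeP1 (n := n)); apply: multiples_sub xyn.
pose Q k := [set g | exists2 s, ~ P s & multiples (f ^+ k) (s * g)].
have idQ k : ideal (Q k).
  apply/idealP; split.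
  - by exists 1; [exact: (prime_ideal1 primeP1)|rewrite mulr0;
    exact: (ideal0 (multiples_ideal _))].
  - move=> u v [s Ps su] [t Pt tv]; exists (s * t); first exact: not_primeM.
    have -> : s * t * (u + v) = t * (s * u) + s * (t * v) by ring.
    by apply: (idealD (multiples_ideal _)); apply: (idealMl (multiples_ideal _)).
  - move=> a u [s Ps su]; exists s => //; rewrite mulrCA.
    exact: (idealMl (multiples_ideal _) _ su).
have decQ k : Q k.+1 `<=` Q k.
  by move=> u [s Ps [t tE]]; exists s => //; exists (t * f); rewrite tE exprS mulrA.
(* the ideals of R/(x) are generated by powers of y, so the image of Q k in
   R/(x) is determined by the set of i with B k i *)
pose B k i := ideal_add (Q k) (multiples x) (y ^+ i).
have decB k i : B k.+1 i -> B k i.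
  by move=> [u [v [/decQ Qu xv yE]]]; exists u, v.
have [k Bk] : exists k, forall i, (i < n)%N -> B k i -> B k.+1 i.
  apply: contrapT => notB.
  pose c k := #|[pred i : 'I_n | `[< B k i >]]|.
  have cS k : (c k.+1 < c k)%N.
    apply/proper_card/properP; split.
      by apply/fintype.subsetP => i /asboolP Bi; apply/asboolP; apply: decB.
    apply: contrapT => nex; apply: notB; exists k => i lt_in Bi; apply: contrapT => nBi.
    by apply: nex; exists (Ordinal lt_in); [apply/asboolP|apply/negP => /asboolP].
  (* the number of i < n with B k i cannot decrease more than n times *)
  have cn k : (c k + k <= n)%N.
    elim: k => [|k IHk]; first by rewrite addn0 -[X in (_ <= X)%N]card_ord max_card.
    by rewrite addnS -addSn; apply: leq_trans IHk; rewrite leq_add2r.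
  by have := cn n.+1; rewrite addnS ltnNge leq_addl.
have Qstep : Q k `<=` Q k.+1.
  apply: (nakayama noethR local (idQ _) (idQ _) mem_mx) => h Qh.
  have xQ : ideal_add (Q k.+1) (multiples x) h.
    have idQx := ideal_add_ideal (idQ k.+1) (multiples_ideal x).
    have [xyh|[j [u [ltj u1 xu]]]] := power_mod_x h n.
      apply: ideal_add_r => //.
      by apply: ideal_add_sub xyh; [apply: multiples_ideal| |apply: multiples_sub;
        first exact: multiples_ideal].
    rewrite -[h](subrK (u * y ^+ j)); apply: idealD => //; first exact: ideal_add_r.
    apply: idealMl => //; apply: Bk => //; apply: (ideal_unitM _ u1).
      exact: ideal_add_ideal (multiples_ideal x).
    rewrite -[u * _](subKr h); apply: idealB;
      first exact: ideal_add_ideal (multiples_ideal x).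
      exact: (ideal_add_l (multiples_ideal x) Qh).
    exact: ideal_add_r.
  have [a [_ [Qa [t ->] hE]]] := xQ; exists a, t; split=> //; last by rewrite mulrC.
  have [s Ps sx] : Q k (t * x).
    by rewrite -[t * x](addKr a) -hE addrC; apply: idealB (decQ _ _ Qa).
  exists (s * x); first exact: not_primeM.
  by have -> : s * x * t = s * (t * x) by ring.
have [s Ps [t tE]] : Q k.+1 (f ^+ k).
  by apply: Qstep; exists 1; [exact: (prime_ideal1 primeP1)|rewrite mul1r;
    apply: multiples_id].
apply: Ps; have -> : s = t * f.
  by apply: (mulIf (expf_neq0 k f0)); rewrite tE exprS mulrA.
exact: idealMl.
Qed.

(** A maximal ideal P among those containing x but no power of y is prime.  Any
element of P is a x + b y with b in P because y is not in P, so P = (x) + y P and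
Nakayama's lemma applies. *)
Lemma multiples_x_prime : has_krull_dim R 2 -> prime_ideal (multiples x).
Proof.
move=> dim2.
have [||P [idP xP Py] Pmax] := @noetherian_max _ noethR
  [set P : set R | [/\ ideal P, multiples x `<=` P & forall n, ~ P (y ^+ n)]] (multiples x).
- by split=> // [|n]; [apply: multiples_ideal|apply: y_not_nilpotent_mod_x].
- by move=> ? [].
have primeP : prime_ideal P.
  apply: mk_prime_ideal => // [|u v Puv]; first by have := Py 0%N; rewrite expr0.
  apply: contrapT => /not_orP[Pu Pv].
  have ext w : ~ P w -> exists n, ideal_add P (multiples w) (y ^+ n).
    move=> Pw; apply: contrapT => nex; apply: Pw.
    apply: (Pmax (ideal_add P (multiples w))).
    - split; first by apply: ideal_add_ideal (multiples_ideal _).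
        by apply: subset_trans (ideal_add_l _) => //; apply: multiples_ideal.
      by move=> n yn; apply: nex; exists n.
    - exact: ideal_add_l (multiples_ideal _).
    - exact: ideal_add_r (multiples_id _).
  have [[i [a [_ [Pa [b ->] iE]]]] [j [c [_ [Pc [d ->] jE]]]]] := (ext u Pu, ext v Pv).
  apply: (Py (i + j)%N); rewrite exprD iE jE.
  have -> : (a + b * u) * (c + d * v) = (c + d * v) * a + (b * u) * c + (b * d) * (u * v)
    by ring.
  by apply: idealD => //; [apply: idealD => //|]; apply: idealMl.
suff -> : multiples x = P by [].
apply/seteqP; split=> //.
apply: (nakayama noethR local (multiples_ideal _) idP mem_my) => g Pg.
have mg : m g by apply: (proper_sub_local noethR local) Pg => //; apply: prime_ideal1.
have [a [b gE]] := mem_local mg; exists (a * x), b; split;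
  [by exists a| |by rewrite gE mulrC [b * y]mulrC [x * a]mulrC].
have [] // := @prime_idealM _ _ primeP b y.
  rewrite -[b * y](addKr (a * x)) -gE addrC; apply: idealB => //.
  by apply: idealMl => //; apply: xP; apply: multiples_id.
by have := Py 1%N; rewrite expr1.
Qed.

End Pair.
End TwoGenerators.

(** * Valuations of the fraction field *)

Section ValuationOfFractions.
Context {R : idomainType}.

Lemma fraction_numden (z : {fraction R}) : exists nd : R * R,
  nd.2 != 0 /\ z = tofrac nd.1 / tofrac nd.2.
Proof.
exists (\n_(generic_quotient.repr z), \d_(generic_quotient.repr z)) => /=.
have d0 : \d_(generic_quotient.repr z) != 0 by apply: denom_ratioP.
split=> //; apply: canRL (mulfK _) _; first by rewrite tofrac_eq0.
rewrite -{1}[z]reprK; unlock tofrac; rewrite -[LHS]FracField.pi_mul.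
apply/eqmodP; rewrite /= FracField.equivfE /FracField.mulf !numden_Ratio ?mulr1 ?oner_eq0
  //.
by rewrite mulrC.
Qed.

Variable w : R -> nat.
Hypothesis wM : forall a b : R, a != 0 -> b != 0 -> w (a * b) = (w a + w b)%N.
Hypothesis wD : forall a b : R, a != 0 -> b != 0 -> a + b != 0 ->
  (minn (w a) (w b) <= w (a + b))%N.
Hypothesis w1 : exists c d : R, [/\ c != 0, d != 0 & w c = (w d).+1].

(** The quotient of two elements with consecutive values is a uniformizer. *)
Lemma extend_valuation : exists2 v : {fraction R} -> int, discrete_valuation v &
  forall a : R, a != 0 -> v (tofrac a) = w a.
Proof.
have [nd Hnd] := choice fraction_numden.
pose v z : int := (w (nd z).1)%:Z - (w (nd z).2)%:Z.
have vE (n d : R) : n != 0 -> d != 0 -> v (tofrac n / tofrac d) = (w n)%:Z - (w d)%:Z.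
  move=> n0 d0; rewrite /v; have [] := Hnd (tofrac n / tofrac d).
  case: (nd _) => n' d' /= d'0 zE.
  have n'0 : n' != 0.
    apply: contraNneq n0 => n'0; move/eqP: zE; rewrite n'0 tofrac0 mul0r mulf_eq0.
    by rewrite invr_eq0 !tofrac_eq0 (negPf d0) orbF.
  have E : n * d' = n' * d.
    apply/eqP; rewrite -tofrac_eq !tofracM; apply/eqP.
    rewrite -[tofrac n](divfK (_ : tofrac d != 0)) ?tofrac_eq0 // zE.
    by rewrite mulrAC divfK ?tofrac_eq0.
  have := congr1 w E; rewrite !wM //; lia.
have fracP (z : {fraction R}) : z != 0 -> exists n d, [/\ n != 0,
  d != 0 & z = tofrac n / tofrac d].
  move=> z0; have [d0 zE] := Hnd z; exists (nd z).1, (nd z).2; split=> //.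
  by apply: contraNneq z0 => n0; rewrite zE n0 tofrac0 mul0r.
have frac0 (n d : R) : (tofrac n / tofrac d == 0 :> {fraction R}) = (n == 0) || (d == 0).
  by rewrite mulf_eq0 invr_eq0 !tofrac_eq0.
have one0 : (1 : R) != 0 by apply: oner_neq0.
have w_1 : w 1 = 0%N by have := wM one0 one0; rewrite mulr1; lia.
have vR (a : R) : a != 0 -> v (tofrac a) = w a.
  by move=> a0; rewrite -[tofrac a]divr1 -tofrac1 vE // w_1 subr0.
exists v; last exact: vR.
split.
- move=> _ _ /fracP[n [d [n0 d0 ->]]] /fracP[n' [d' [n'0 d'0 ->]]].
  rewrite mulf_div -!tofracM !vE ?mulf_neq0 // !wM //; lia.
- move=> _ _ /fracP[n [d [n0 d0 ->]]] /fracP[n' [d' [n'0 d'0 ->]]].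
  rewrite addf_div ?tofrac_eq0 // -!tofracM -tofracD frac0 negb_or => /andP[nn dd].
  have := wD (mulf_neq0 n0 d'0) (mulf_neq0 n'0 d0) nn.
  rewrite !vE // !wM // ge_min; lia.
- have [c [d [c0 d0 cd]]] := w1.
  have wX (a : R) k : a != 0 -> w (a ^+ k) = (k * w a)%N.
    move=> a0; elim: k => [|k IHk]; first by rewrite expr0 w_1.
    by rewrite exprS wM ?expf_neq0 // IHk mulSn.
  have X0 (a : R) k : a != 0 -> a ^+ k != 0 by apply: expf_neq0.
  case=> k.
    exists (tofrac (c ^+ k) / tofrac (d ^+ k)); first
      by rewrite frac0 !expf_eq0 (negPf c0) (negPf d0) !andbF.
    rewrite vE ?X0 // !wX // cd; lia.
  exists (tofrac (d ^+ k.+1) / tofrac (c ^+ k.+1)); first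
    by rewrite frac0 !expf_eq0 (negPf c0) (negPf d0) !andbF.
  rewrite vE ?X0 // !wX // cd; lia.
Qed.
End ValuationOfFractions.

(** * Complete ideals and Newton polygons *)

Section Completeness.
Context {R : comNzRingType} (I : set R).
Hypothesis completeI : complete_ideal I.

Lemma ideal_pow_ideal n : ideal (ideal_pow I n).
Proof. exact: ideal_gen_ideal. Qed.

Lemma ideal_powM g h i j : I g -> I h -> ideal_pow I (i + j) (g ^+ i * h ^+ j).
Proof.
move=> Ig Ih; apply: ideal_gen_sub.
exists (fun k : 'I_(i + j) => if (k < i)%N then g else h); first by move=> k /=; case: ifP.
rewrite big_split_ord /= (eq_bigr (fun=> g)); last by move=> k _; rewrite ltn_ord.
rewrite prodr_const card_ord (eq_bigr (fun=> h)) ?prodr_const ?card_ord //.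
by move=> k _; rewrite ltnNge leq_addr.
Qed.

Lemma complete_root z n : (0 < n)%N -> ideal_pow I n (z ^+ n) -> I z.
Proof.
move=> n0 zn; rewrite -completeI.
(* the equation of integral dependence is z^n - z^n = 0 *)
exists n, (fun i => if i == n then - z ^+ n else 0); split.
  move=> i _; case: eqP => [->|_]; last exact: ideal0 (ideal_pow_ideal _).
  exact: idealN (ideal_pow_ideal _) _ _.
case: n n0 zn => // n _ _; rewrite big_nat_recr //= eqxx subnn expr0 mulr1 big_nat big1;
  first by rewrite add0r subrr.
by move=> i /andP[_ lt_in]; rewrite ltn_eqF ?mul0r.
Qed.
End Completeness.

Lemma rat_between (s1 s2 : seq rat) : s1 != [::] ->
  {in s1 & s2, forall u v, u < v} ->
  exists c, {in s1, forall u, u < c} /\ {in s2, forall v, c < v}.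
Proof.
move=> s1n lt12.
have [M Ms1 maxM] : exists2 M, M \in s1 & {in s1, forall u, u <= M}.
  elim: s1 s1n {lt12} => // u s1 IHs _; case: (eqVneq s1 [::]) => [->|/IHs[M Ms maxM]].
    by exists u; rewrite ?mem_head // => v; rewrite inE => /eqP->.
  case: (leP u M) => [uM|/ltW Mu].
    by exists M; rewrite ?inE ?Ms ?orbT // => v; rewrite inE => /orP[/eqP->//|/maxM].
  exists u; first exact: mem_head.
  by move=> v; rewrite inE => /orP[/eqP->//|/maxM /le_trans->].
case: (eqVneq s2 [::]) => [->|s2n].
  by exists (M + 1); split=> // u /maxM; lra.
have [N Ns2 minN] : exists2 N, N \in s2 & {in s2, forall u, N <= u}.
  elim: s2 s2n {lt12} => // u s2 IHs _; case: (eqVneq s2 [::]) => [->|/IHs[N Ns minN]].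
    by exists u; rewrite ?mem_head // => v; rewrite inE => /eqP->.
  case: (leP N u) => [uM|/ltW Mu].
    by exists N; rewrite ?inE ?Ns ?orbT // => v; rewrite inE => /orP[/eqP->//|/minN].
  exists u; first exact: mem_head.
  by move=> v; rewrite inE => /orP[/eqP->//|/minN]; apply: le_trans.
have MN := lt12 _ _ Ms1 Ns2.
by exists ((M + N) / 2%:R); split=> u; [move/maxM|move/minN]; lra.
Qed.

(** The admissible slopes p/q are those in between finitely many lower and upper
bounds, one for each generator on either side of the abscissa s; the convexity
hypothesis says that each lower bound is below each upper bound. *)
Lemma newton_separation r (a b : nat -> nat) s t :
  (s < a 0)%N -> b 0%N = 0%N ->
  (forall i, (i <= r)%N -> ~~ ((a i <= s) && (b i <= t))%N) ->
  (forall k l, (k <= r)%N -> (l <= r)%N -> (a l < s)%N -> (s < a k)%N ->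
     (t * (a k - a l) < b k * (s - a l) + b l * (a k - s))%N) ->
  exists p q, [/\ (0 < p)%N, (0 < q)%N, coprime p q &
    forall i, (i <= r)%N -> (p * s + q * t < p * a i + q * b i)%N].
Proof.
move=> sa0 b0 notin conv.
pose lo := [seq (t%:R - (b k)%:R) / ((a k)%:R - s%:R) : rat | k <- iota 0 r.+1 & (s < a
  k)%N].
pose hi := [seq ((b l)%:R - t%:R) / (s%:R - (a l)%:R) : rat | l <- iota 0 r.+1 & (a l <
  s)%N].
have lo0 : (t%:R - (b 0%N)%:R) / ((a 0%N)%:R - s%:R) \in lo by apply: map_f;
  rewrite mem_filter sa0.
have [||c [c_lo c_hi]] := @rat_between lo hi.
- by apply: contraTneq lo0 => ->.
- move=> _ _ /mapP[k + ->] /mapP[l + ->].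
  rewrite !mem_filter !mem_iota !add0n !ltnS => /andP[sk /= kr] /andP[ls /= lr].
  have : (t * (a k - a l))%:R < (b k * (s - a l) + b l * (a k - s))%:R :> rat.
    by rewrite ltr_nat; apply: conv.
  rewrite natrD !natrM (natrB _ (ltnW sk)) (natrB _ (ltnW ls)) (natrB _ (ltnW (ltn_trans
    ls sk))).
  have : (a l)%:R < s%:R :> rat by rewrite ltr_nat.
  have : s%:R < (a k)%:R :> rat by rewrite ltr_nat.
  rewrite -(subr_gt0 (s%:R)) -(subr_gt0 (a l)%:R) => ak al H.
  rewrite ltr_pdivrMr // mulrAC ltr_pdivlMr //; nra.
have c0 : 0 < c.
  apply: le_lt_trans (c_lo _ lo0); rewrite b0 subr0 divr_ge0 //.
  by rewrite subr_ge0 ler_nat ltnW.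
pose p := `|numq c|%N; pose q := `|denq c|%N.
have pE : p%:R = (numq c)%:~R :> rat by rewrite /p natr_absz ger0_norm // ltW // numq_gt0.
have qE : q%:R = (denq c)%:~R :> rat by rewrite /q natr_absz ger0_norm.
have q0 : (0 < q)%N by rewrite absz_gt0.
have q0' : 0 < q%:R :> rat by rewrite ltr0n.
have cq : c * q%:R = p%:R by rewrite pE qE -[X in X * _]divq_num_den divfK // intr_eq0.
exists p, q; split=> //; first by rewrite absz_gt0 gt_eqF ?numq_gt0.
  exact: coprime_num_den.
move=> i ir; case: (ltngtP s (a i)) => [si|is_|eqs].
- have : (t%:R - (b i)%:R) / ((a i)%:R - s%:R) \in lo.
    by apply: map_f; rewrite mem_filter si mem_iota.
  move/c_lo; rewrite ltr_pdivrMr ?subr_gt0 ?ltr_nat // -(ltr_pM2r q0') mulrAC cq.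
  by rewrite -(ltr_nat rat) !natrD !natrM; lra.
- have : ((b i)%:R - t%:R) / (s%:R - (a i)%:R) \in hi.
    by apply: map_f; rewrite mem_filter is_ mem_iota.
  move/c_hi; rewrite ltr_pdivlMr ?subr_gt0 ?ltr_nat // -(ltr_pM2r q0') mulrAC cq.
  by rewrite -(ltr_nat rat) !natrD !natrM; lra.
- have := notin i ir; rewrite -eqs leqnn /= -ltnNge => bt.
  by rewrite ltn_add2l ltn_pmul2l.
Qed.

(** * Monomials in a regular system of parameters *)

Section RegularParameters.
Context {R : idomainType} (m : set R) (x y : R).
Hypothesis noethR : noetherian_ring R.
Hypothesis local : local_ring m.
Hypothesis mxy : m = ideal_gen [set x; y].
Hypothesis primex : prime_ideal (multiples x).
Hypothesis xNy : ~ multiples x y.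
Hypothesis x0 : x != 0.

Definition irreducible_ideal (s t : nat) : set R :=
  ideal_add (multiples (x ^+ s)) (multiples (y ^+ t)).
Local Notation Q s t := (irreducible_ideal s t).

Lemma irreducible_ideal_ideal s t : ideal (Q s t).
Proof. by apply: ideal_add_ideal; apply: multiples_ideal. Qed.

Lemma multiples_exp_coprime s t z :
  multiples (x ^+ s) (y ^+ t * z) -> multiples (x ^+ s) z.
Proof.
elim: s z => [|s IHs] z; first by exists z; rewrite expr0 mulr1.
move=> [c cE]; have [|/(prime_idealX primex)//|[d dE]] := prime_idealM primex (u :=
  y ^+ t) (v := z).
  by exists (c * x ^+ s); rewrite cE exprSr mulrA.
have [|e eE] := IHs d; last by exists e; rewrite dE eE exprSr mulrA.
by exists c; apply: (mulIf x0); rewrite -!mulrA -dE cE exprSr.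
Qed.

Lemma parameter_y_neq0 : y != 0.
Proof. by apply/eqP => parameter_y_neq0; apply: xNy; rewrite parameter_y_neq0;
  apply: ideal0 (multiples_ideal _). Qed.

(** This takes the place of expansions in monomials: the monomials that do not
divide x^s y^t vanish modulo (x^(s+1), y^(t+1)), so that the coefficient of
x^s y^t can be read there, modulo m. *)
Lemma monomial_coef s t c : Q s.+1 t.+1 (c * (x ^+ s * y ^+ t)) -> m c.
Proof.
move=> [_ [_ [[p ->] [q ->] E]]].
have E1 : x ^+ s * (c * y ^+ t - p * x) = y ^+ t.+1 * q.
  by rewrite mulrBr mulrCA E !exprSr; ring.
(* x and y form a regular sequence, so both powers can be cancelled in turn *)
have [q' qE] : multiples (x ^+ s) q.
  by apply: (@multiples_exp_coprime _ t.+1); rewrite -E1 mulrC; eexists.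
have E2 : c * y ^+ t - p * x = q' * y ^+ t.+1.
  by apply: (mulfI (expf_neq0 s x0)); rewrite E1 qE; ring.
have [w wE] : multiples (x ^+ 1) (c - q' * y).
  apply: (@multiples_exp_coprime _ t); exists p; rewrite expr1.
  have -> : y ^+ t * (c - q' * y) = c * y ^+ t - q' * y ^+ t.+1 by rewrite exprS; ring.
  by rewrite -E2; ring.
rewrite -[c](subrK (q' * y)) wE expr1; have idm := local_ideal local.
by apply: idealD => //; apply: idealMl => //; [apply: (mem_mx mxy)|apply: (mem_my mxy)].
Qed.

Lemma unit_monomial_notin s t c : c \is a GRing.unit ->
  ~ Q s.+1 t.+1 (c * (x ^+ s * y ^+ t)).
Proof. by move=> /(unit_not_local local) mc /monomial_coef. Qed.

Lemma zero_ideal : ideal [set 0 : R].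
Proof. by apply/idealP; split=> // [u v -> ->|a u ->]; rewrite /= ?addr0 ?mulr0. Qed.

Lemma extract_power_x g : g != 0 -> exists k g', g = x ^+ k * g' /\ ~ multiples x g'.
Proof.
move=> /eqP g0; have [|k [g' [gE xg']]] :=
  exact_power noethR local zero_ideal (mem_mx mxy) _ g0.
  by move=> w /= /eqP; rewrite mulf_eq0 (negPf x0) => /eqP.
exists k, g'; split; first by apply/eqP; rewrite -subr_eq0; apply/eqP.
by move=> xg; apply: xg'; apply: ideal_add_r zero_ideal _ xg.
Qed.

Lemma unit_power_mod_x g : ~ multiples x g ->
  exists i u, u \is a GRing.unit /\ multiples x (g - u * y ^+ i).
Proof.
move=> xg; have [|t [u [uE xu]]] := exact_power noethR local (multiples_ideal x) (mem_my
  mxy) _ xg.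
  by move=> w /(prime_idealM primex)[].
exists t, u; split; last by rewrite mulrC.
apply: (local_unit noethR local) => /(mem_local mxy)[a [b uE']]; apply: xu.
by exists (a * x), (b * y); split=> //; [exists a|exists b].
Qed.

(** Extract the exact power of x from g, then the exact power of y modulo x. *)
Lemma nonzero_notin_irreducible g : g != 0 -> exists s t, ~ Q s.+1 t.+1 g.
Proof.
move=> /extract_power_x[s [h [gE /unit_power_mod_x[t [u [u1 [d dE]]]]]]].
exists s, t => Qg; apply: (@unit_monomial_notin s t _ u1).
have -> : u * (x ^+ s * y ^+ t) = g - x ^+ s * (h - u * y ^+ t) by rewrite gE; ring.
apply: (idealB (irreducible_ideal_ideal _ _)) => //; apply: ideal_add_l;
  first exact: multiples_ideal.
by rewrite dE; exists d; rewrite exprSr; ring.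
Qed.

Lemma irreducible_ideal_monomial s t i j : ((s <= i) || (t <= j))%N ->
  Q s t (x ^+ i * y ^+ j).
Proof.
case/orP => [le_si|le_tj].
  apply: ideal_add_l; first exact: multiples_ideal.
  by exists (x ^+ (i - s) * y ^+ j); rewrite -{1}(subnK le_si) exprD; ring.
apply: ideal_add_r; first exact: multiples_ideal.
by exists (x ^+ i * y ^+ (j - t)); rewrite -{1}(subnK le_tj) exprD; ring.
Qed.

Lemma irreducible_ideal_colon s t c h : Q s (c + t) (y ^+ c * h) -> Q s t h.
Proof.
move=> [_ [_ [[p ->] [q ->] E]]].
have [w wE] : multiples (x ^+ s) (h - q * y ^+ t).
  by apply: (@multiples_exp_coprime _ c); exists p; rewrite mulrBr E exprD; ring.
by exists (w * x ^+ s), (q * y ^+ t); split; [exists w|exists q|rewrite -wE subrK].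
Qed.

Section MonomialIdeal.
Variables (r : nat) (a b : nat -> nat).
Definition monomial_ideal : set R :=
  ideal_gen [set x ^+ a i * y ^+ b i | i in [set i : nat | (i <= r)%N]].

Lemma monomial_ideal_ideal : ideal monomial_ideal.
Proof. exact: ideal_gen_ideal. Qed.

Lemma monomial_ideal_sub J : ideal J ->
  (forall i, (i <= r)%N -> J (x ^+ a i * y ^+ b i)) -> monomial_ideal `<=` J.
Proof. by move=> idJ Jg; apply: ideal_gen_min => // _ [i /= ir <-]; apply: Jg. Qed.

Lemma monomial_ideal_mem i s t :
  (i <= r)%N -> (a i <= s)%N -> (b i <= t)%N -> monomial_ideal (x ^+ s * y ^+ t).
Proof.
move=> ir as_ bt.
have -> : x ^+ s * y ^+ t = (x ^+ (s - a i) * y ^+ (t - b i)) * (x ^+ a i * y ^+ b i).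
  by rewrite -{1}(subnK as_) -{1}(subnK bt) !exprD; ring.
by apply: (idealMl monomial_ideal_ideal); apply: ideal_gen_sub; exists i.
Qed.

Lemma monomial_ideal_unit c s t : c \is a GRing.unit ->
  monomial_ideal (c * (x ^+ s * y ^+ t)) -> exists i, [/\ (i <= r)%N,
    (a i <= s)%N & (b i <= t)%N].
Proof.
move=> c1 Ic; apply: contrapT => nex; apply: (@unit_monomial_notin s t c c1).
apply: monomial_ideal_sub Ic; first exact: irreducible_ideal_ideal.
move=> i ir; apply: irreducible_ideal_monomial; rewrite -[(_ || _)]negbK negb_or -!leqNgt.
by apply/negP => /andP[ai bi]; apply: nex; exists i; split.
Qed.

(** The corners of the staircase give an irreducible decomposition.  Adding the
generators one at a time, an element is known modulo the first k+1 generators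
and y^(b_(k+1)), and the next irreducible component constrains the coefficient
of y^(b_(k+1)). *)
Lemma monomial_ideal_decomposition g : (0 < r)%N -> a r = 0%N -> b 0%N = 0%N ->
  (forall i, (i < r)%N -> (a i.+1 <= a i)%N) ->
  (forall i, (i < r)%N -> (b i <= b i.+1)%N) ->
  (forall i, (i < r)%N -> Q (a i) (b i.+1) g) -> monomial_ideal g.
Proof.
move=> r_gt0 ar b0 adec binc Qg.
pose J k := ideal_gen [set x ^+ a i * y ^+ b i | i in [set i : nat | (i <= k)%N]].
have idJ k : ideal (J k) by apply: ideal_gen_ideal.
have JS k : J k `<=` J k.+1.
  by apply: ideal_gen_mono => _ [i /= ik <-]; exists i => //=; apply: leqW.
have Ja k : (k <= r)%N -> J k `<=` multiples (x ^+ a k).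
  move=> kr; apply: ideal_gen_min; first exact: multiples_ideal.
  move=> _ [i /= ik <-].
  have le_a : (a k <= a i)%N.
    elim: k ik kr {J idJ JS} => [|k IHk]; first by rewrite leqn0 => /eqP->.
    rewrite leq_eqVlt => /orP[/eqP -> //|ik kr].
    by apply: (leq_trans (adec k kr)); apply: IHk => //; apply: ltnW.
  by exists (x ^+ (a i - a k) * y ^+ b i); rewrite -{1}(subnK le_a) exprD; ring.
have step k : (k < r)%N -> ideal_add (J k) (multiples (y ^+ b k.+1)) g.
  elim: k => [|k IHk] kr.
    have [u [v [[p pE] yv ->]]] := Qg _ kr; exists u, v; split=> //.
    rewrite pE; apply: (idealMl (idJ 0%N)); apply: ideal_gen_sub.
    by exists 0%N => //; rewrite b0 expr0 mulr1.
  have [u [_ [Ju [h ->] gE]]] := IHk (ltnW kr).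
  have [q [p hE]] : exists q p, h = p * x ^+ a k.+1 + q * y ^+ (b k.+2 - b k.+1).
    suff [_ [_ [[p ->] [q ->] ->]]] : Q (a k.+1) (b k.+2 - b k.+1) h by exists q, p.
    apply: (@irreducible_ideal_colon _ _ (b k.+1)); rewrite subnKC ?binc //.
    have -> : y ^+ b k.+1 * h = g - u by rewrite gE; ring.
    apply: idealB; [exact: irreducible_ideal_ideal|exact: Qg|].
    apply: ideal_add_l; first exact: multiples_ideal.
    exact: (Ja k.+1 (ltnW kr) _ (JS _ _ Ju)).
  exists (u + p * (x ^+ a k.+1 * y ^+ b k.+1)), (q * y ^+ b k.+2); split.
  - apply: (idealD (idJ _)); first exact: JS.
    by apply: (idealMl (idJ _)); apply: ideal_gen_sub; exists k.+1 => /=.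
  - by exists q.
  - by rewrite gE hE -[in RHS](subnK (binc _ kr)) exprD; ring.
have := step r.-1; rewrite prednK // leqnn => /(_ isT) [u [v [Ju [q ->] ->]]].
apply: (idealD monomial_ideal_ideal).
  by move: Ju; apply: ideal_gen_mono => _ [i /= ir <-]; exists i => //=;
    apply: leq_trans ir (leq_pred _).
apply: (idealMl monomial_ideal_ideal); apply: ideal_gen_sub.
by exists r => //=; rewrite ar expr0 mul1r.
Qed.

End MonomialIdeal.

(** * Monomial valuations *)

Section MonomialValuation.
Variables p q : nat.
Hypotheses (p_gt0 : (0 < p)%N) (q_gt0 : (0 < q)%N).

Definition weight i j := (p * i + q * j)%N.
(** The rank orders the monomials lexicographically by weight, then by exponent
of x; since i <= weight i j, this order on pairs can be encoded in a single
natural number. *)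
Definition lex_rank i j := (weight i j ^ 2 + i)%N.
Definition lex_ideal c : set R :=
  ideal_gen [set x ^+ ij.1 * y ^+ ij.2 | ij in [set ij : nat * nat | (c <= lex_rank ij.1
    ij.2)%N]].

Lemma lex_rank_lt s t i j : (lex_rank s t < lex_rank i j)%N =
  (weight s t < weight i j)%N || (weight s t == weight i j) && (s < i)%N.
Proof.
have ls : (s <= weight s t)%N by rewrite /weight; nia.
have li : (i <= weight i j)%N by rewrite /weight; nia.
rewrite /lex_rank; move: (weight s t) (weight i j) ls li => n k ls li.
by case: (ltngtP n k) => [nk|kn|<-] /=; [|apply/negbTE|]; rewrite ?ltn_add2l // -?leqNgt;
  nia.
Qed.

Lemma lex_rank_le s t i j : (lex_rank s t <= lex_rank i j)%N =
  (weight s t < weight i j)%N || (weight s t == weight i j) && (s <= i)%N.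
Proof.
by rewrite leqNgt lex_rank_lt negb_or negb_and -!leqNgt leq_eqVlt eq_sym; case: ltngtP.
Qed.

Lemma weightD s t i j : weight (s + i) (t + j) = (weight s t + weight i j)%N.
Proof. by rewrite /weight; lia. Qed.

Lemma lex_ideal_ideal c : ideal (lex_ideal c).
Proof. exact: ideal_gen_ideal. Qed.

Lemma lex_ideal_mono c d : (c <= d)%N -> lex_ideal d `<=` lex_ideal c.
Proof. by move=> cd; apply: ideal_gen_mono => _ [ij /= le_d <-]; exists ij => //=;
  apply: leq_trans cd _. Qed.

Lemma lex_ideal_mem c i j : (c <= lex_rank i j)%N -> lex_ideal c (x ^+ i * y ^+ j).
Proof. by move=> le_c; apply: ideal_gen_sub; exists (i, j). Qed.

Lemma lex_ideal_sub_irreducible s t c : (lex_rank s t < c)%N ->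
  lex_ideal c `<=` irreducible_ideal s.+1 t.+1.
Proof.
move=> lt_c; apply: ideal_gen_min; first exact: irreducible_ideal_ideal.
move=> _ [[i j] /= le_c <-]; apply: irreducible_ideal_monomial; apply/contraT.
rewrite negb_or -!leqNgt => /andP[is_ jt]; move: (leq_trans lt_c le_c).
by rewrite lex_rank_lt /weight; nia.
Qed.

Lemma lex_idealM s t s' t' f h :
  lex_ideal (lex_rank s t).+1 f -> lex_ideal (lex_rank s' t') h ->
  lex_ideal (lex_rank (s + s') (t + t')).+1 (f * h).
Proof.
set c := (lex_rank (s + s') (t + t')).+1; have idc := lex_ideal_ideal c.
pose J h := [set f | lex_ideal c (f * h)].
have idJ k : ideal (J k).
  apply/idealP; rewrite /J /=; split=> [|u v Ju Jv|a u Ju]; rewrite /=.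
  - by rewrite mul0r; apply: (ideal0 idc).
  - by rewrite mulrDl; apply: (idealD idc).
  - by rewrite -mulrA; apply: (idealMl idc).
move=> Tf Th; move: f Tf; apply: (ideal_gen_min (idJ h)) => _ [[i j] /= le_ij <-].
rewrite /J /= mulrC; move: h Th; apply: (ideal_gen_min (idJ _)) => _ [[i' j'] /= le_ij' <-].
rewrite /J /= mulrACA -!exprD; apply: lex_ideal_mem.
move: le_ij le_ij'; rewrite /c lex_rank_lt lex_rank_le lex_rank_lt !weightD.
by case/orP => [?|/andP[/eqP ? ?]]; case/orP => [?|/andP[/eqP ? ?]]; apply/orP; (left;
  lia) || (right; lia).
Qed.

(** The smallest monomial of g for the order of [lex_rank]; breaking the ties
between monomials of the same weight makes initial monomials multiplicative. *)
Definition initial_monomial g s t :=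
  exists2 u, u \is a GRing.unit & lex_ideal (lex_rank s t).+1 (g - u * (x ^+ s * y ^+ t)).

Lemma initial_monomial_mem g s t : initial_monomial g s t -> lex_ideal (lex_rank s t) g.
Proof.
move=> [u _ gu]; rewrite -[g](subrK (u * (x ^+ s * y ^+ t))).
have idc := lex_ideal_ideal (lex_rank s t).
by apply: (idealD idc); [apply: lex_ideal_mono gu|apply: (idealMl idc);
  apply: lex_ideal_mem].
Qed.

Lemma initial_monomial_le g s t c : initial_monomial g s t -> lex_ideal c g ->
  (c <= lex_rank s t)%N.
Proof.
move=> [u u1 gu] cg; rewrite leqNgt; apply/negP => lt_c.
apply: (unit_monomial_notin (s := s) (t := t) u1).
have idQ := irreducible_ideal_ideal s.+1 t.+1.
rewrite -[u * _](subKr g); apply: idealB => //; first exact: lex_ideal_sub_irreducible cg.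
exact: lex_ideal_sub_irreducible gu.
Qed.

(** Otherwise g lies in all the ideals [lex_ideal c], since a monomial of rank c
could only occur in g with coefficient in m, and then its contribution has a
larger rank; but [lex_ideal c] is contained in any given (x^(s+1), y^(t+1))
for c large. *)
Lemma initial_monomial_exists g : g != 0 -> exists s t, initial_monomial g s t.
Proof.
move=> g0; apply: contrapT => nex.
have [s [t]] := nonzero_notin_irreducible g0; apply.
suff gc c : lex_ideal c g by apply: lex_ideal_sub_irreducible (gc (lex_rank s t).+1).
elim: c => [|c IHc].
  rewrite -[g]mulr1; apply: (idealMl (lex_ideal_ideal _)).
  by have := @lex_ideal_mem 0 0 0 isT; rewrite !expr0 mulr1.
have idc := lex_ideal_ideal c.+1.
have [[i [j cE]]|nc] := pselect (exists i j, lex_rank i j = c); last first.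
  move: IHc; apply: ideal_gen_mono => _ [[i j] /= le_c <-]; exists (i, j) => //=.
  by rewrite ltn_neqAle le_c andbT; apply/eqP => cE; apply: nc; exists i, j.
have : ideal_add (lex_ideal c.+1) (multiples (x ^+ i * y ^+ j)) g.
  move: IHc; apply: ideal_gen_min; first by apply: ideal_add_ideal => //;
    apply: multiples_ideal.
  move=> _ [[k l] /= le_c <-]; move: le_c; rewrite leq_eqVlt => /orP[/eqP ckl|ckl].
    apply: ideal_add_r => //.
    have eij : lex_rank i j = lex_rank k l by rewrite cE.
    have lt1 : (lex_rank i j < lex_rank k l)%N = false by rewrite eij ltnn.
    have lt2 : (lex_rank k l < lex_rank i j)%N = false by rewrite eij ltnn.
    move: lt1 lt2; rewrite !lex_rank_lt => lt1 lt2.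
    have ki : k = i by lia.
    have lj : l = j by move: lt1 lt2; rewrite /weight ki; nia.
    by rewrite ki lj; apply: multiples_id.
  by apply: ideal_add_l; [apply: multiples_ideal|apply: lex_ideal_mem].
move=> [f [_ [cf [a ->] gE]]].
have [ma|/(local_unit noethR local) a1] := pselect (m a); last first.
  by case: nex; exists i, j, a; rewrite // gE addrK cE.
rewrite gE; apply: (idealD idc) => //.
have [b [d ->]] := mem_local mxy ma.
have -> : (b * x + d * y) * (x ^+ i * y ^+ j) =
   b * (x ^+ i.+1 * y ^+ j) + d * (x ^+ i * y ^+ j.+1) by rewrite !exprSr; ring.
apply: (idealD idc); apply: (idealMl idc); apply: lex_ideal_mem;
  rewrite -cE lex_rank_lt /weight; nia.
Qed.

Lemma initial_monomialM g h s t s' t' : initial_monomial g s t ->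
  initial_monomial h s' t' ->
  initial_monomial (g * h) (s + s') (t + t').
Proof.
move=> gst hst; have h_mem := initial_monomial_mem hst; case: gst hst => u u1 gu [v v1 hv].
exists (u * v); first by rewrite unitrM u1.
set f := x ^+ s * y ^+ t in gu *; set f' := x ^+ s' * y ^+ t' in hv *.
have -> : g * h - u * v * (x ^+ (s + s') * y ^+ (t + t')) =
    (g - u * f) * h + (h - v * f') * (u * f) by rewrite /f /f' !exprD; ring.
apply: (idealD (lex_ideal_ideal _)); first exact: lex_idealM.
rewrite addnC [(t + _)%N]addnC; apply: lex_idealM => //.
by apply: (idealMl (lex_ideal_ideal _)); apply: lex_ideal_mem.
Qed.

(** The valuation is the weight of the initial monomial.  If g is outside
(x^(s+1), y^(t+1)), this weight is at most that of x^s y^t whatever the choice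
of p and q; this is what allows to choose p and q afterwards. *)
Lemma monomial_valuation : coprime p q ->
  exists w : R -> nat,
  [/\ forall g h : R, g != 0 -> h != 0 -> w (g * h) = (w g + w h)%N,
      forall g h : R, g != 0 -> h != 0 -> g + h != 0 -> (minn (w g) (w h) <= w (g + h)%R)%N,
      exists c d : R, [/\ c != 0, d != 0 & w c = (w d).+1],
      forall (g : R) s t, g != 0 -> ~ irreducible_ideal s.+1 t.+1 g ->
        (w g <= weight s t)%N &
      forall r (a b : nat -> nat) n, (forall i, (i <= r)%N -> (n < weight (a i) (b i))%N) ->
         forall h : R, h != 0 -> monomial_ideal r a b h -> (n < w h)%N].
Proof.
move=> pq.
have /choice[w Hw] (g : R) : exists n, g != 0 -> exists s t,
  initial_monomial g s t /\ n = weight s t.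
  have [->|g0] := eqVneq g 0; first by exists 0%N.
  by have [s [t gst]] := initial_monomial_exists g0; exists (weight s t) => _; exists s, t.
have wE (g : R) s t : g != 0 -> initial_monomial g s t -> w g = weight s t.
  move=> g0 gst; have [s' [t' [gst' ->]]] := Hw g g0.
  have := initial_monomial_le gst' (initial_monomial_mem gst).
  have := initial_monomial_le gst (initial_monomial_mem gst').
  rewrite !lex_rank_le; lia.
have w_mon s t : w (x ^+ s * y ^+ t) = weight s t.
  apply: wE; first by rewrite mulf_neq0 // expf_neq0 // parameter_y_neq0.
  exists 1; first exact: unitr1.
  by rewrite mul1r subrr; apply: ideal0 (lex_ideal_ideal _).
exists w; split.
- move=> g h g0 h0; have [s [t [gst ->]]] := Hw g g0; have [s' [t' [hst ->]]] := Hw h h0.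
  by rewrite (wE _ _ _ (mulf_neq0 g0 h0) (initial_monomialM gst hst)) weightD.
- move=> g h g0 h0 gh0; have [s [t [gst ->]]] := Hw g g0; have [s' [t' [hst ->]]] :=
  Hw h h0.
  have [s2 [t2 [ghst ->]]] := Hw _ gh0.
  have : (minn (lex_rank s t) (lex_rank s' t') <= lex_rank s2 t2)%N.
    apply: (initial_monomial_le ghst); apply: (idealD (lex_ideal_ideal _)).
      by apply: lex_ideal_mono (initial_monomial_mem gst); apply: geq_minl.
    by apply: lex_ideal_mono (initial_monomial_mem hst); apply: geq_minr.
  rewrite !geq_min !lex_rank_le; lia.
- have : coprime p q by []. move=> /eqP gcd1.
  have [kp kq] := egcdnP q p_gt0; rewrite gcd1 => E _.
  exists (x ^+ kp * y ^+ 0), (x ^+ 0 * y ^+ kq).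
  by rewrite !w_mon !mulf_neq0 ?expf_neq0 ?parameter_y_neq0 // /weight; split=> //; lia.
- move=> g s t g0 gQ; have [i [j [gst ->]]] := Hw g g0.
  rewrite leqNgt; apply/negP => lt_w; apply: gQ.
  by apply: lex_ideal_sub_irreducible (initial_monomial_mem gst); rewrite lex_rank_lt lt_w.
- move=> r a b n nab h h0 Ih; have [s [t [hst ->]]] := Hw h h0.
  rewrite ltnNge; apply/negP => le_n.
  suff : lex_ideal (lex_rank s t).+1 h by move/(initial_monomial_le hst); rewrite ltnn.
  apply: monomial_ideal_sub Ih; first exact: lex_ideal_ideal.
  move=> i ir; apply: lex_ideal_mem; rewrite lex_rank_lt; apply/orP; left.
  exact: leq_ltn_trans le_n (nab i ir).
Qed.

End MonomialValuation.

(** * Complete monomial ideals are determined by valuations *)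

Section Criterion.
Variables (r : nat) (a b : nat -> nat).
Hypotheses (r_gt0 : (0 < r)%N) (ar : a r = 0%N) (b0 : b 0%N = 0%N).
Hypotheses (adec : forall i, (i < r)%N -> (a i.+1 < a i)%N)
           (binc : forall i, (i < r)%N -> (b i < b i.+1)%N).
Local Notation I := (monomial_ideal r a b).
Hypothesis completeI : complete_ideal I.

Lemma b_mono i j : (i <= j <= r)%N -> (b i <= b j)%N.
Proof.
elim: j => [|j IHj]; first by rewrite leqn0 andbT => /eqP->.
case/andP; rewrite leq_eqVlt => /orP[/eqP->//|ij jr].
by apply: leq_trans (ltnW (binc jr)); apply: IHj; rewrite -ltnS ij ltnW.
Qed.
Lemma a_mono i j : (i <= j <= r)%N -> (a j <= a i)%N.
Proof.
elim: j => [|j IHj]; first by rewrite leqn0 andbT => /eqP->.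
case/andP; rewrite leq_eqVlt => /orP[/eqP->//|ij jr].
by apply: leq_trans (ltnW (adec jr)) _; apply: IHj; rewrite -ltnS ij ltnW.
Qed.

Lemma complete_convex k l s t : (k <= r)%N -> (l <= r)%N -> (a l < s)%N -> (s < a k)%N ->
  (b k * (s - a l) + b l * (a k - s) <= t * (a k - a l))%N -> I (x ^+ s * y ^+ t).
Proof.
move=> kr lr ls sk le_t; have n_gt0 : (0 < a k - a l)%N by lia.
apply: (complete_root completeI n_gt0).
set g := x ^+ a k * y ^+ b k; set h := x ^+ a l * y ^+ b l.
have Ig : I g by apply: ideal_gen_sub; exists k.
have Ih : I h by apply: ideal_gen_sub; exists l.
have nE : (a k - a l = (s - a l) + (a k - s))%N by lia.
set d := (t * (a k - a l) - (b k * (s - a l) + b l * (a k - s)))%N.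
have -> : (x ^+ s * y ^+ t) ^+ (a k - a l) = y ^+ d * (g ^+ (s - a l) * h ^+ (a k - s)).
  rewrite /g /h !exprMn -!exprM.
  have -> : (s * (a k - a l) = a k * (s - a l) + a l * (a k - s))%N by nia.
  have -> : (t * (a k - a l) = d + (b k * (s - a l) + b l * (a k - s)))%N by rewrite subnK.
  by rewrite !exprD; ring.
by rewrite nE; apply: (idealMl (ideal_pow_ideal _ _)); apply: ideal_powM.
Qed.

(** A J as in the hypothesis contains the extension of I to V, so the hypothesis
says that g lies in the extension of I to every V.  An element g outside I is
outside some irreducible component (x^(s+1), y^(t+1)) of I, where x^s y^t is
a corner monomial not in I; a line separating (s, t) from the exponents of I
gives a monomial valuation with v(g) <= v(x^s y^t) < v(I). *)
Lemma valuative_criterion g :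
  (forall V : set {fraction R}, dvr_of V -> range (@tofrac R) `<=` V ->
     forall J : set {fraction R}, J 0 -> (forall u v, J u -> J v -> J (u + v)) ->
       (forall c u, V c -> J u -> J (c * u)) ->
       (forall h, I h -> J (tofrac h)) -> J (tofrac g)) -> I g.
Proof.
move=> Vg; apply: contrapT => Ig.
have [i ir Qi] : exists2 i, (i < r)%N & ~ irreducible_ideal (a i) (b i.+1) g.
  apply: contrapT => nex; apply: Ig; apply: (monomial_ideal_decomposition) => //.
  - by move=> i /adec/ltnW.
  - by move=> i /binc/ltnW.
  - by move=> i ir; apply: contrapT => Qi; apply: nex; exists i.
set s := (a i).-1; set t := (b i.+1).-1.
have sE : a i = s.+1 by rewrite prednK //; have := adec ir; lia.
have tE : b i.+1 = t.+1 by rewrite prednK //; have := binc ir; lia.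
have Ist : forall j, (j <= r)%N -> ~~ ((a j <= s) && (b j <= t))%N.
  move=> j jr; apply/negP => /andP[aj bj].
  case: (leqP j i) => [ji|ij].
    have : (a i <= a j)%N by apply: a_mono; rewrite ji ltnW.
    lia.
  have : (b i.+1 <= b j)%N by apply: b_mono; rewrite ij.
  lia.
have [||p [q [p_gt0 q_gt0 pq sep]]] := @newton_separation r a b s t _ b0 Ist.
- by have := @a_mono 0 i; rewrite sE leq0n (ltnW ir); apply.
- move=> k l kr lr al ak; rewrite ltnNge; apply/negP => le_t.
  have := complete_convex kr lr al ak le_t.
  rewrite -[_ * _]mul1r => /(monomial_ideal_unit (unitr1 _))[j [jr aj bj]].
  by have := Ist j jr; rewrite aj bj.
have g0 : g != 0 by apply/eqP => g0; apply: Ig; rewrite g0;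
  apply: ideal0 (ideal_gen_ideal _).
have [w [wM wD w1 wQ wI]] := monomial_valuation p_gt0 q_gt0 pq.
have [v dv vE] := extend_valuation wM wD w1.
have [vM vD _] := dv.
have v_gt h : h != 0 -> I h -> v (tofrac g) + 1 <= v (tofrac h).
  move=> h0 Ih; rewrite !vE //.
  have := wQ g s t g0; rewrite -sE -tE => /(_ Qi).
  have := wI r a b (weight p q s t) sep h h0 Ih; lia.
have := Vg [set z | z = 0 \/ 0 <= v z] _ _ [set z | z = 0 \/ v (tofrac g) + 1 <= v z].
case.
- by exists v.
- move=> _ [z _ <-]; have [->|z0] := eqVneq z 0; first by left; rewrite tofrac0.
  by right; rewrite vE.
- by left.
- move=> z1 z2 /= [->|z1v]; first by rewrite add0r.
  move=> [->|z2v]; first by rewrite addr0; right.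
  have [->|z10] := eqVneq z1 0; first by rewrite add0r; right.
  have [->|z20] := eqVneq z2 0; first by rewrite addr0; right.
  have [|z120] := eqVneq (z1 + z2) 0; [by left | right].
  by apply: le_trans (vD _ _ z10 z20 z120); rewrite le_min z1v.
- move=> c u /= [->|cv]; first by rewrite mul0r; left.
  move=> [->|uv]; first by rewrite mulr0; left.
  have [->|c0] := eqVneq c 0; first by rewrite mul0r; left.
  have [->|u0] := eqVneq u 0; first by rewrite mulr0; left.
  by right; rewrite vM //; lia.
- move=> h Ih; have [->|h0] := eqVneq h 0; first by left; rewrite tofrac0.
  by right; apply: v_gt.
- by move/eqP; rewrite tofrac_eq0 (negPf g0).
- lia.
Qed.

End Criterion.

(** * Regular local rings of dimension two are normal *)

Definition almost_integral (h : R) : set R :=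
  [set c | exists2 d, d != 0 & forall n, multiples (h ^+ n) (d * c ^+ n)].

Lemma almost_integral_ideal h : ideal (almost_integral h).
Proof.
apply/idealP; split.
- by exists 1; [apply: oner_neq0|case=> [|n]; [exists 1;
  rewrite !expr0 |rewrite expr0n mulr0; apply: ideal0 (multiples_ideal _)]].
- move=> u v [d d0 du] [d' d'0 dv]; exists (d * d'); first exact: mulf_neq0.
  move=> n; rewrite exprDn mulr_sumr; apply: ideal_sum (multiples_ideal _) _ _ _ _ _ => i _.
  have [s sE] := du (n - i)%N; have [t tE] := dv i.
  have -> : d * d' * (u ^+ (n - i) * v ^+ i *+ 'C(n, i)) =
      ((d * u ^+ (n - i)) * (d' * v ^+ i)) *+ 'C(n, i).
    by rewrite mulrnAr; congr (_ *+ _); ring.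
  exists (s * t *+ 'C(n, i)); rewrite sE tE mulrnAl; congr (_ *+ _).
  by rewrite -[in RHS](subnK (_ : i <= n)%N) ?exprD; [ring | rewrite -ltnS].
- move=> a u [d d0 du]; exists d => // n.
  by rewrite exprMn mulrCA; apply: idealMl (multiples_ideal _) _ _ (du n).
Qed.

Lemma multiples_cancel w z k : ~ multiples x w -> multiples w (x ^+ k * z) -> multiples w z.
Proof.
move=> xw; elim: k z => [|k IHk] z; first by rewrite expr0 mul1r.
rewrite exprSr -mulrA => /IHk[s sE].
have xsw : multiples x (s * w) by exists z; rewrite -sE mulrC.
have [[s' s'E]|//] := prime_idealM primex xsw.
by exists s'; apply: (mulfI x0); rewrite sE s'E; ring.
Qed.

Lemma ideal_subX (A : set R) g g' n : ideal A -> A (g - g') -> A (g ^+ n - g' ^+ n).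
Proof. by move=> idA Ag; rewrite subrXX; apply: idealMr. Qed.

Lemma almost_integral_cancel h c : ~ multiples x h ->
  almost_integral h (x * c) -> almost_integral h c.
Proof.
move=> xh [d d0 dc]; exists d => // n; apply: (@multiples_cancel _ _ n).
  by move=> /(prime_idealX primex).
by rewrite mulrCA -exprMn.
Qed.

(** Let T be the ideal of the c such that c/h is almost integral over R.  The
ring R/(x) is a discrete valuation ring with uniformizer y, so the class of an
element of T is a multiple of that of h; hence T = (h) + x T, and Nakayama's
lemma gives T = (h). *)
Lemma almost_integral_mem_coprime h : ~ multiples x h -> almost_integral h `<=` multiples h.
Proof.
move=> xh; have idT := almost_integral_ideal h.
apply: (nakayama noethR local (multiples_ideal h) idT (mem_mx mxy)) => c Tc.
have [[c1 cE]|xc] := pselect (multiples x c).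
  exists 0, c1; split; [exact: ideal0 (multiples_ideal _)| |by rewrite add0r cE mulrC].
  by apply: almost_integral_cancel => //; rewrite mulrC -cE.
have [d d0 dc] := Tc; have [k [d' [dE xd']]] := extract_power_x d0.
have {}dc n : multiples (h ^+ n) (d' * c ^+ n).
  apply: (@multiples_cancel _ _ k); first by move=> /(prime_idealX primex).
  by rewrite mulrA -dE.
have [i [u [u1 cu]]] := unit_power_mod_x xc.
have [l [u' [u'1 du]]] := unit_power_mod_x xd'.
have [j [u2 [u21 hu]]] := unit_power_mod_x xh.
have idx := multiples_ideal x.
(* compare the orders in y modulo x of both sides of d' c^n = s h^n *)
have le_n n : (j * n <= l + i * n)%N.
  have [s sE] := dc n; rewrite leqNgt; apply/negP => lt_n.
  apply: (unit_monomial_notin (s := 0) (t := (l + i * n)%N) (c := u' * u ^+ n)).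
    by rewrite unitrM u'1 unitrX.
  have [e eE] : multiples x ((u' * y ^+ l) * (u * y ^+ i) ^+ n - s * (u2 * y ^+ j) ^+ n).
    have -> : (u' * y ^+ l) * (u * y ^+ i) ^+ n - s * (u2 * y ^+ j) ^+ n =
       s * (h ^+ n - (u2 * y ^+ j) ^+ n) - (d' * (c ^+ n - (u * y ^+ i) ^+ n)
         + (d' - u' * y ^+ l) * (u * y ^+ i) ^+ n).
      by rewrite mulrBr -sE; ring.
    apply: (idealB idx); first by apply: (idealMl idx); apply: ideal_subX.
    by apply: (idealD idx); [apply: (idealMl idx); apply: ideal_subX|apply: (idealMr idx)].
  rewrite expr0 mul1r exprD exprM.
  exists (e * x), (s * (u2 * y ^+ j) ^+ n); split; first by exists e.
    exists (s * u2 ^+ n * y ^+ (j * n - (l + i * n).+1)).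
    by rewrite -mulrA -exprD subnK // exprM exprMn mulrA.
  by rewrite -eE exprMn; ring.
have ji : (j <= i)%N by rewrite leqNgt; apply/negP => ij; have := le_n l.+1; nia.
pose a := u * u2^-1 * y ^+ (i - j).
have [c1 c1E] : multiples x (c - a * h).
  have -> : c - a * h = (c - u * y ^+ i) - a * (h - u2 * y ^+ j).
    have -> : u * y ^+ i = a * (u2 * y ^+ j).
      by rewrite /a -{1}(subnK ji) exprD -[in LHS](divrK u21 u); ring.
    by ring.
  by apply: (idealB idx) => //; apply: (idealMl idx).
exists (a * h), c1; split; first by exists a.
  apply: almost_integral_cancel => //; rewrite mulrC -c1E.
  apply: (idealB idT) => //; apply: (idealMl idT).
  by exists 1; [apply: oner_neq0|move=> n; rewrite mul1r; apply: multiples_id].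
by rewrite [x * _]mulrC -c1E addrC subrK.
Qed.

Lemma almost_integral_mem h : h != 0 -> almost_integral h `<=` multiples h.
Proof.
move=> h0 g [d d0 dg]; have [->|g0] := eqVneq g 0; first exact: ideal0 (multiples_ideal _).
have [k [h' [hE xh']]] := extract_power_x h0.
have [j [g' [gE xg']]] := extract_power_x g0.
have [l [d' [dE xd']]] := extract_power_x d0.
have le_n n : (k * n <= l + j * n)%N.
  have [s sE] := dg n; rewrite leqNgt; apply/negP => lt_n.
  have : multiples x (d' * g' ^+ n).
    exists (s * h' ^+ n * x ^+ (k * n - (l + j * n).+1)).
    apply: (mulfI (expf_neq0 (l + j * n) x0)).
    transitivity (d * g ^+ n); first by rewrite dE gE exprMn exprD exprM; ring.
    rewrite sE hE exprMn -exprM -{1}(subnK lt_n) exprD exprS; ring.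
  by case/(prime_idealM primex) => // /(prime_idealX primex).
have kj : (k <= j)%N by rewrite leqNgt; apply/negP => ij; have := le_n l.+1; nia.
have gE' : g = x ^+ k * (x ^+ (j - k) * g') by rewrite gE mulrA -exprD subnKC.
have [t tE] : multiples h' (x ^+ (j - k) * g').
  apply: almost_integral_mem_coprime => //; exists d => // n; have [s sE] := dg n; exists s.
  apply: (mulfI (expf_neq0 n (expf_neq0 k x0))).
  transitivity (d * g ^+ n); first by rewrite gE' mulrCA [in RHS]exprMn.
  by rewrite sE hE exprMn; ring.
by exists t; rewrite hE mulrCA -tE -gE'.
Qed.

(** If z = n/h is not in R, the ideals of denominators ((h) : t n), for t n
outside (h), have a maximal element P, which is prime.  Either P (t n)/h is
contained in P, and then (t n)/h is almost integral over R, or P R_P is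
principal, and then R_P is a discrete valuation ring in which (t n)/h has
value -1, so that z has a negative value. *)
Lemma fraction_in_all_dvr z :
  (forall V : set {fraction R}, dvr_of V -> range (@tofrac R) `<=` V -> V z) ->
  exists g, z = tofrac g.
Proof.
move=> Vz; have [[n h] [/= h0 zE]] := fraction_numden z.
have h0' : tofrac h != 0 by rewrite tofrac_eq0.
have [[g gE]|hn] := pselect (multiples h n).
  by exists g; rewrite zE gE tofracM mulfK.
exfalso; have idh := multiples_ideal h.
pose colon t := [set c | multiples h (c * (t * n))].
have idc t : ideal (colon t).
  apply/idealP; rewrite /colon /=; split=> [|u v Ju Jv|a u Ju]; rewrite /=.
  - by rewrite mul0r; apply: (ideal0 idh).
  - by rewrite mulrDl; apply: (idealD idh).
  - by rewrite -mulrA; apply: (idealMl idh).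
have [||P [tau htau PE] Pmax] := @noetherian_max _ noethR
   [set P | exists2 t, ~ multiples h (t * n) & P = colon t] (colon 1).
- by exists 1; rewrite ?mul1r.
- by move=> _ [t _ ->].
have idP : ideal P by rewrite PE.
have P1 : ~ P 1 by rewrite PE /colon /= mul1r.
have primeP : prime_ideal P.
  apply: mk_prime_ideal => // u v Puv; have [Pv|Pv] := pselect (P v); [by right|left].
  apply: (Pmax (colon (v * tau))).
  - by exists (v * tau) => // hv; apply: Pv; rewrite PE /colon /= mulrA.
  - by rewrite PE => c /= hc; rewrite /colon /= -[v * _ * _]mulrA mulrCA;
    apply: (idealMl idh).
  - by move: Puv; rewrite PE /colon /= -!mulrA.
have Ph : P h by rewrite PE; exists (tau * n); rewrite mulrC.
have [[a [b [Pa abE Pb]]]|nex] :=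
    pselect (exists a b, [/\ P a, a * (tau * n) = b * h & ~ P b]); last first.
  apply: htau; apply: (almost_integral_mem h0); exists h => // k.
  suff [b _ ->] : exists2 b, P b & h * (tau * n) ^+ k = b * h ^+ k by exists b.
  elim: k => [|k [b Pb bE]]; first by exists h; rewrite ?expr0 ?mulr1.
  have [b' b'E] : multiples h (b * (tau * n)) by move: Pb; rewrite PE.
  exists b'; first by apply: contrapT => Pb'; apply: nex; exists b, b'.
  by rewrite exprSr mulrA bE mulrAC b'E exprS mulrA.
have a0 : a != 0.
  apply/eqP => a0; apply: Pb; move/esym/eqP: abE;
    rewrite a0 mul0r mulf_eq0 (negPf h0) orbF => /eqP->.
  exact: ideal0.
have divP c : P c -> exists c', c * b = a * c'.
  rewrite PE => -[c' c'E]; exists c'; apply: (mulIf h0).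
  by rewrite -mulrA -abE mulrCA c'E mulrA.
(* the P-adic order: a generates the maximal ideal of R_P *)
pose ordP c k := exists s t, [/\ ~ P s, ~ P t & s * c = a ^+ k * t].
have ord_lt c k k' s t : ordP c k -> ~ P s -> s * c = a ^+ k' * t -> (k' <= k)%N.
  move=> [s' [t' [Ps' Pt' E']]] Ps E; rewrite leqNgt; apply/negP => lt_k.
  suff Pst : P (s * t') by have [] := prime_idealM primeP Pst.
  have -> : s * t' = a * (a ^+ (k' - k.+1) * (s' * t)).
    apply: (mulfI (expf_neq0 k a0)); rewrite mulrCA -E' mulrCA E -{1}(subnK lt_k) exprD
      exprS; ring.
  exact: idealMr.
have ord_ex c : c != 0 -> exists k, ordP c k.
  move=> c0; pose B k := [set w | exists2 s, ~ P s & multiples c (s * (a ^+ k * w))].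
  have idB k : ideal (B k).
    apply/idealP; split.
    - by exists 1 => //; rewrite !mulr0; apply: ideal0 (multiples_ideal _).
    - move=> u v [s Ps su] [t Pt tv]; exists (s * t); first exact: not_primeM.
      have -> : s * t * (a ^+ k * (u + v)) = t * (s * (a ^+ k * u)) + s * (t * (a ^+ k *
        v)) by ring.
      by apply: (idealD (multiples_ideal c)); apply: (idealMl (multiples_ideal c)).
    - move=> e u [s Ps su]; exists s => //.
      have -> : s * (a ^+ k * (e * u)) = e * (s * (a ^+ k * u)) by ring.
      exact: (idealMl (multiples_ideal c)).
  (* the ascending chain of the B k bounds the powers of a that divide c in R_P *)
  have [k Bk] : exists k, B k.+1 `<=` B k.
    apply: (noetherian_chain noethR idB) => k u [s Ps su]; exists s => //.
    have -> : s * (a ^+ k.+1 * u) = a * (s * (a ^+ k * u)) by rewrite exprS; ring.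
    exact: (idealMl (multiples_ideal c)).
  have bound k' : (exists s t, ~ P s /\ s * c = a ^+ k' * t) -> (k' <= k)%N.
    move=> [s [t [Ps E]]]; rewrite leqNgt; apply/negP => lt_k.
    have E1 : s * c = a ^+ k.+1 * (a ^+ (k' - k.+1) * t) by rewrite mulrA -exprD subnKC.
    have [s' Ps' [w wE]] : B k (a ^+ (k' - k.+1) * t).
      by apply: Bk; exists 1 => //; rewrite mul1r -E1; exists s.
    suff Pss : P (s' * s) by have [] := prime_idealM primeP Pss.
    have -> : s' * s = a * w.
      apply: (mulIf c0); rewrite -mulrA E1 exprS -mulrA -[in RHS]mulrA -wE; ring.
    exact: idealMr.
  have exk : exists k', `[< exists s t, ~ P s /\ s * c = a ^+ k' * t >].
    by exists 0%N; apply/asboolP; exists 1, c; rewrite expr0 !mul1r.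
  have ubk k' : `[< exists s t, ~ P s /\ s * c = a ^+ k' * t >] -> (k' <= k)%N.
    by move/asboolP; apply: bound.
  case: (ex_maxnP exk ubk) => k' /asboolP[s [t [Ps E]]] maxk.
  exists k', s, t; split=> // Pt; have [t' t'E] := divP t Pt.
  suff /maxk : `[< exists s t, ~ P s /\ s * c = a ^+ k'.+1 * t >] by rewrite ltnn.
  apply/asboolP; exists (b * s), t'; split; first exact: not_primeM.
  by rewrite -mulrA E mulrCA [b * t]mulrC t'E exprSr mulrA.
have /choice[w Hw] c : exists k, c != 0 -> ordP c k.
  by have [->|/ord_ex[k]] := eqVneq c 0; [exists 0%N|exists k].
have wE c k : c != 0 -> ordP c k -> w c = k.
  move=> c0 ck; have cw := Hw c c0; apply/eqP; rewrite eqn_leq.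
  have [s [t [Ps Pt E]]] := ck; have [s' [t' [Ps' Pt' E']]] := cw.
  by rewrite (ord_lt _ _ _ _ _ ck Ps' E') (ord_lt _ _ _ _ _ cw Ps E).
have wM c d : c != 0 -> d != 0 -> w (c * d) = (w c + w d)%N.
  move=> c0 d0; apply: wE; first exact: mulf_neq0.
  have [s [t [Ps Pt E]]] := Hw c c0; have [s' [t' [Ps' Pt' E']]] := Hw d d0.
  exists (s * s'), (t * t'); split; [exact: not_primeM|exact: not_primeM|].
  by rewrite mulrACA E E' exprD; ring.
have wD (c d : R) : c != 0 -> d != 0 -> c + d != 0 -> (minn (w c) (w d) <= w (c + d)%R)%N.
  move=> c0 d0 cd0; have [s [t [Ps Pt E]]] := Hw c c0; have [s' [t' [Ps' Pt' E']]] :=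
    Hw d d0.
  set k := minn _ _.
  apply: (ord_lt (c + d) _ _ (s * s')
     (s' * (a ^+ (w c - k) * t) + s * (a ^+ (w d - k) * t')) (Hw _ cd0));
       first exact: not_primeM.
  have -> : s * s' * (c + d) = s' * (s * c) + s * (s' * d) by ring.
  rewrite E E' -{1}(subnK (geq_minl (w c) (w d))) -/k -{1}(subnK (geq_minr (w c) (w d)))
    -/k.
  by rewrite !exprD; ring.
have wunit c : ~ P c -> w c = 0%N.
  move=> Pc; apply: wE; first by apply/eqP => c0; apply: Pc; rewrite c0; apply: ideal0.
  by exists 1, c; rewrite expr0 !mul1r.
have wa : w a = 1%N by apply: wE => //; exists 1, 1; rewrite mul1r expr1 mulr1.
have w1 : exists c d : R, [/\ c != 0, d != 0 & w c = (w d).+1].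
  by exists a, 1; rewrite a0 oner_neq0 wa wunit.
have [v dv vE] := extend_valuation wM wD w1; have [vM _ _] := dv.
have tau_n0 : tau * n != 0.
  by apply: contra_not_neq htau => ->; apply: (ideal0 idh).
move: (tau_n0); rewrite mulf_eq0 negb_or => /andP[tau0 n0].
have [||/eqP|] := Vz [set z | z = 0 \/ 0 <= v z].
- by exists v.
- move=> _ [c _ <-]; have [->|c0] := eqVneq c 0; first by left; rewrite tofrac0.
  by right; rewrite vE.
- by rewrite zE mulf_eq0 invr_eq0 !tofrac_eq0 (negPf n0) (negPf h0).
have z0 : z != 0 by rewrite zE mulf_eq0 invr_eq0 !tofrac_eq0 (negPf n0) (negPf h0).
have b0' : b != 0 by apply/eqP => b0; apply: Pb; rewrite b0; apply: ideal0.
have := vM z (tofrac h) z0 h0'; rewrite {1}zE divfK // !vE //.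
have := congr1 w abE; rewrite !wM // wa (wunit b Pb); lia.
Qed.

End RegularParameters.

(** * Submodules as modules *)

Section SpanTools.
Context {R : comNzRingType} {V : lmodType R}.
Implicit Types N : set V.

Lemma submoduleP N : submodule N <->
  [/\ N 0, forall u v, N u -> N v -> N (u + v) & forall a u, N u -> N (a *: u)].
Proof.
split=> [[N0 Nlin]|[N0 ND NZ]].
  have {}N0 : N 0 by move: N0; rewrite inE.
  have {}Nlin a u v : N u -> N v -> N (a *: u + v).
    by move=> Nu Nv; have := Nlin a u v; rewrite !inE; apply.
  split=> // [u v Nu Nv|a u Nu]; first by have := Nlin 1 u v Nu Nv; rewrite scale1r.
  by have := Nlin a u 0 Nu N0; rewrite addr0.
split; first by rewrite inE.
by move=> a u v; rewrite !inE => Nu Nv; apply: ND => //; apply: NZ.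
Qed.

Section Closure.
Variable N : set V.
Hypothesis subN : submodule N.
Lemma submod0 : N 0. Proof. by case/submoduleP: subN. Qed.
Lemma submodD u v : N u -> N v -> N (u + v).
Proof. by case/submoduleP: subN => _ + _; apply. Qed.
Lemma submodZ a u : N u -> N (a *: u).
Proof. by case/submoduleP: subN => _ _; apply. Qed.
Lemma submodB u v : N u -> N v -> N (u - v).
Proof. by move=> Nu Nv; apply: submodD => //; rewrite -scaleN1r; apply: submodZ. Qed.
Lemma submod_sum (T : Type) (r : seq T) (P : pred T) (F : T -> V) :
  (forall i, P i -> N (F i)) -> N (\sum_(i <- r | P i) F i).
Proof. by move=> NF; elim/big_rec: _ => [|i u Pi]; [apply: submod0 | apply: submodD;
  apply: NF]. Qed.
End Closure.

Lemma span_sub (A : set V) : A `<=` Defs.span A.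
Proof. by move=> u Au; apply: sub_gen_smallest. Qed.
Lemma span_min (A : set V) N : submodule N -> A `<=` N -> Defs.span A `<=` N.
Proof. by move=> subN AN; apply: smallest_sub. Qed.
Lemma span_id N : submodule N -> Defs.span N = N.
Proof. exact: smallest_id. Qed.

Lemma span_range (n : nat) (g : 'I_n -> V) z : Defs.span (range g) z ->
  exists c : 'I_n -> R, z = \sum_i c i *: g i.
Proof.
apply: (@span_min _ [set w | exists c : 'I_n -> R, w = \sum_i c i *: g i]).
  apply/submoduleP; split.
  - by exists (fun=> 0); rewrite big1 // => i _; rewrite scale0r.
  - move=> _ _ [c ->] [d ->]; exists (fun i => c i + d i).
    by rewrite -big_split; apply: eq_bigr => i _; rewrite scalerDl.
  - move=> a _ [c ->]; exists (fun i => a * c i).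
    by rewrite scaler_sumr; apply: eq_bigr => i _; rewrite scalerA.
move=> _ [i _ <-]; exists (fun j => (j == i)%:R).
by rewrite (bigD1 i) //= eqxx scale1r big1 ?addr0 // => j /negPf->; rewrite scale0r.
Qed.

Lemma span_setU (A B : set V) z : submodule A -> submodule B -> Defs.span (A `|` B) z ->
  exists u v, [/\ A u, B v & z = u + v].
Proof.
move=> sA sB; apply: (@span_min _ [set w | exists u v, [/\ A u, B v & w = u + v]]).
  apply/submoduleP; split.
  - by exists 0, 0; split; rewrite ?addr0 //; apply: submod0.
  - move=> _ _ [u [v [Au Bv ->]]] [u' [v' [Au' Bv' ->]]]; exists (u + u'), (v + v').
    by split; rewrite 1?addrACA //; apply: submodD.
  - move=> a _ [u [v [Au Bv ->]]]; exists (a *: u), (a *: v).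
    by split; rewrite ?scalerDr //; apply: submodZ.
move=> w [Aw|Bw].
  by exists w, 0; split; rewrite ?addr0 //; apply: submod0.
by exists 0, w; split; rewrite ?add0r //; apply: submod0.
Qed.
End SpanTools.

Section SubmoduleType.
Context {R : comNzRingType} {V : lmodType R} (N : set V).

(** Taking the proof as an argument makes it available to the canonical
structures of the subtype. *)
Definition submod_pred (subN : submodule N) : {pred V} := fun v => v \in N.
Variable subN : submodule N.
HB.instance Definition _ := GRing.isSubmodClosed.Build R V (submod_pred subN)
  (GRing.submod_closed_semi subN).

Record submod_type := SubmodType { submod_val : V;
  submod_valP : submod_val \in submod_pred subN }.
HB.instance Definition _ := [isSub for submod_val].
HB.instance Definition _ := [Choice of submod_type by <:].
HB.instance Definition _ := [SubChoice_isSubLmodule of submod_type by <:].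

Definition mk_submod v (Nv : N v) : submod_type := SubmodType (mem_set Nv).
Lemma mk_submodK v (Nv : N v) : submod_val (mk_submod Nv) = v.
Proof. by []. Qed.
Lemma submod_val_mem (u : submod_type) : N (submod_val u).
Proof. exact: set_mem (submod_valP u). Qed.
Lemma submod_val_inj : injective submod_val.
Proof. exact: val_inj. Qed.
Lemma submod_valD u v : submod_val (u + v) = submod_val u + submod_val v.
Proof. by []. Qed.
Lemma submod_valZ a u : submod_val (a *: u) = a *: submod_val u.
Proof. by []. Qed.
Lemma submod_val0 : submod_val 0 = 0.
Proof. by []. Qed.
End SubmoduleType.

Section NoetherianModule.
Context {R : comNzRingType}.
Hypothesis noethR : noetherian_ring R.

(** By induction on k, for the elements of N whose coordinates from k on vanish:
the possible k-th coordinates form a finitely generated ideal. *)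
Lemma row_submodule_fg n (N : set 'rV[R]_n) : submodule N ->
  exists s : seq 'rV[R]_n, [set` s] `<=` N /\ N `<=` Defs.span [set` s].
Proof.
move=> subN.
suff gen k : (k <= n)%N -> exists s : seq 'rV[R]_n, [set` s] `<=` N /\
    forall u, N u -> (forall j : 'I_n, (k <= j)%N -> u 0 j = 0) -> Defs.span [set` s] u.
  have [s [sN sG]] := gen n (leqnn n).
  by exists s; split=> // u Nu; apply: sG => // j; rewrite leqNgt ltn_ord.
elim: k => [|k IHk] kn.
  exists [::]; split=> // u Nu u0.
  suff -> : u = 0 by apply: submod0; apply: span_submodule.
  by apply/rowP => j; rewrite mxE u0.
have [s [sN sG]] := IHk (ltnW kn); pose k' := Ordinal kn.
pose Nk := [set u | N u /\ forall j : 'I_n, (k < j)%N -> u 0 j = 0].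
pose J := [set c | exists2 u, Nk u & c = u 0 k'].
have idJ : ideal J.
  apply/idealP; split.
  - exists 0; last by rewrite mxE.
    by split=> [|j _]; [apply: submod0|rewrite mxE].
  - move=> _ _ [u [Nu u0] ->] [v [Nv v0] ->]; exists (u + v); last by rewrite mxE.
    by split=> [|j kj]; [apply: submodD|rewrite mxE u0 ?v0 ?addr0].
  - move=> a _ [u [Nu u0] ->]; exists (a *: u); last by rewrite mxE.
    by split=> [|j kj]; [apply: submodZ|rewrite mxE u0 ?mulr0].
have [t tE] := noethR idJ.
have /choice[f Hf] (i : 'I_(size t)) : exists u, Nk u /\ t`_i = u 0 k'.
  have [u Nu uE] : J t`_i by rewrite tE; apply: ideal_gen_sub; apply: mem_nth.
  by exists u.
pose ft := [seq f i | i <- enum 'I_(size t)].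
exists (ft ++ s); split.
  by move=> v /=; rewrite mem_cat => /orP[/mapP[i _ ->]|/sN //]; case: (Hf i) => -[].
move=> u Nu u0.
have [|c cE] := @ideal_gen_seq _ t (u 0 k'); first by rewrite -tE; exists u.
have sp : submodule (Defs.span [set` ft ++ s]) by apply: span_submodule.
rewrite -[u](subrK (\sum_i c i *: f i)); apply: (submodD sp); last first.
  apply: (submod_sum sp) => i _; apply: (submodZ sp); apply: span_sub.
  by rewrite /= mem_cat map_f // mem_enum.
have : Defs.span [set` s] (u - \sum_i c i *: f i).
  apply: sG.
    by apply: submodB => //; apply: submod_sum => // i _; apply: submodZ => //;
      case: (Hf i) => -[].
  move=> j; rewrite leq_eqVlt => /orP[/eqP kj|kj].
    have -> : j = k' by apply: val_inj.
    rewrite mxE cE !mxE summxE [X in _ - X](eq_bigr (fun i => c i * t`_i)) ?subrr //.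
    by move=> i _; rewrite mxE (proj2 (Hf i)).
  rewrite mxE u0 // !mxE summxE big1 ?subrr // => i _.
  by have [[_ f0] _] := Hf i; rewrite mxE f0 // mulr0.
apply: span_min => // v /= vs; apply: span_sub; by rewrite /= mem_cat vs orbT.
Qed.

Lemma submod_type_fg n (N : set 'rV[R]_n) (subN : submodule N) :
  finitely_generated (submod_type subN).
Proof.
have [s [sN sG]] := row_submodule_fg subN.
pose f v : submod_type subN := if pselect (N v) is left Nv then mk_submod subN Nv else 0.
have fK v : N v -> submod_val (f v) = v by rewrite /f; case: pselect.
exists [seq f v | v <- s]; apply/seteqP; split=> // u _.
have sp : submodule (Defs.span [set` [seq f v | v <- s]]) by apply: span_submodule.
have : [set v | exists2 w : submod_type subN,
  Defs.span [set` [seq f v | v <- s]] w & submod_val w = v]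
   (submod_val u).
  move: (submod_val u) (submod_val_mem u) => v /sG; move: v; apply: span_min.
    apply/submoduleP; split.
    - by exists 0; [apply: (submod0 sp)|].
    - by move=> _ _ [w sw <-] [w' sw' <-]; exists (w + w'); first exact: (submodD sp).
    - by move=> a _ [w sw <-]; exists (a *: w); first exact: (submodZ sp).
  move=> v /= vs; exists (f v); last by rewrite fK //; apply: sN.
  by apply: span_sub; rewrite /= map_f.
by move=> [w sw] /submod_val_inj <-.
Qed.
End NoetherianModule.

(** * Extension of scalars of a module of rows *)

Section BaseChange.
Context {R : idomainType} (e : nat) (M : lmodType R) (iota : M -> 'rV[R]_e).
Hypotheses (iota_linear : linear iota) (iota_inj : injective iota).
Local Notation K := {fraction R}.
Local Notation tensor := (@to_base_change R M).

Lemma iota0 : iota 0 = 0.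
Proof. by rewrite -[0 in LHS](addNr 0) -scaleN1r iota_linear scaleN1r addNr. Qed.

Definition free_coord (z : @monalg.malg M K) : 'rV[K]_e :=
  \row_i monalg.mmap idfun (fun u : M => tofrac (iota u 0 i)) z.

Lemma free_coordD z z' : free_coord (z + z') = free_coord z + free_coord z'.
Proof. by apply/rowP => i; rewrite !mxE monalg.mmapD. Qed.

Lemma free_coordZ a z : free_coord (a *: z) = a *: free_coord z.
Proof.
apply/rowP => i; rewrite !mxE (monalg.mmapEw (monalg.msuppZ_le _ _)) monalg.mmapE mulr_sumr.
by apply: eq_bigr => k _; rewrite monalg.mcoeffZ /= mulrA.
Qed.

Lemma free_coordB z z' : free_coord (z - z') = free_coord z - free_coord z'.
Proof. by apply/rowP => i; rewrite !mxE monalg.mmapB. Qed.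

Lemma free_coordU u : free_coord (@monalg.mkmalgU M K u 1) = map_mx (@tofrac R) (iota u).
Proof. by apply/rowP => i; rewrite !mxE monalg.mmapU mul1r. Qed.

Lemma free_coord_relations z : Defs.span (@base_change_relations R M) z -> free_coord z = 0.
Proof.
apply: (@span_min _ _ _ [set z | free_coord z = 0]).
  apply/submoduleP; split=> /=.
  - by rewrite -[0](scale0r 0) free_coordZ scale0r.
  - by move=> u v u0 v0; rewrite free_coordD u0 v0 addr0.
  - by move=> a u u0; rewrite free_coordZ u0 scaler0.
move=> _ [a [u [v ->]]]; rewrite /= free_coordB free_coordD free_coordZ !free_coordU.
by rewrite iota_linear map_mxD map_mxZ subrr.
Qed.

(** The coordinates in K^e of an element of the extension of scalars of M,
viewed as a module of rows by means of iota. *)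
Definition coord (w : base_change M) : 'rV[K]_e :=
  free_coord (generic_quotient.repr (w : Quotient.quot _)).

Lemma coord_proj z : coord (quot_proj (@base_change_relations R M) z) = free_coord z.
Proof.
apply/eqP; rewrite -subr_eq0 -free_coordB; apply/eqP.
apply: free_coord_relations; apply: set_mem; apply/quot_projP;
  exact: generic_quotient.reprK.
Qed.

Lemma coordD (w w' : base_change M) : coord (w + w') = coord w + coord w'.
Proof.
move: w w'; apply: quot_projW => z; apply: quot_projW => z'.
by rewrite -quot_projD !coord_proj free_coordD.
Qed.

Lemma coordZ a (w : base_change M) : coord (a *: w) = a *: coord w.
Proof.
by move: w; apply: quot_projW => z; rewrite [a *: _]quot_projZ !coord_proj free_coordZ.
Qed.

Lemma coord_tensor u : coord (tensor u) = map_mx (@tofrac R) (iota u).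
Proof. by rewrite coord_proj free_coordU. Qed.

Lemma coord_sum (n : nat) (F : 'I_n -> base_change M) : coord (\sum_i F i) = \sum_i coord
  (F i).
Proof.
apply: big_morph; first exact: coordD.
by rewrite -[0](scale0r 0) coordZ scale0r.
Qed.

Lemma tensor_linear a u v : tensor (a *: u + v) = tofrac a *: tensor u + tensor v.
Proof.
have -> : tofrac a *: tensor u =
    quot_proj (@base_change_relations R M) (tofrac a *: @monalg.mkmalgU M K u 1).
  exact: quot_projZ.
rewrite -quot_projD; apply/quot_projP.
by apply: mem_set; apply: span_sub; exists a, u, v.
Qed.

Lemma tensor0 : tensor 0 = 0.
Proof. by rewrite -[0 in LHS](addNr 0) -scaleN1r tensor_linear tofracN tofrac1 scaleN1r
  addNr. Qed.

Lemma tensorD u v : tensor (u + v) = tensor u + tensor v.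
Proof. by rewrite -[u]scale1r tensor_linear tofrac1 !scale1r. Qed.

Lemma tensorZ a u : tensor (a *: u) = tofrac a *: tensor u.
Proof. by rewrite -[a *: u]addr0 tensor_linear tensor0 addr0. Qed.

Lemma base_change_denom (w : base_change M) : exists d u,
  d != 0 /\ tofrac d *: w = tensor u.
Proof.
move: w; apply: quot_projW => z; rewrite (monalg.monalgE z).
elim/big_rec: _ => [|u z' _ [d [v [d0 dE]]]].
  exists 1, 0; rewrite oner_neq0 tensor0; split=> //.
  have p0 : quot_proj (@base_change_relations R M) 0 = 0 by apply: raddf0.
  by rewrite p0 scaler0.
have [[n h] [/= h0 cE]] := fraction_numden (monalg.mcoeff u z).
exists (h * d), ((n * d) *: u + h *: v); rewrite mulf_neq0 //; split=> //.
have mE : monalg.mkmalgU u (monalg.mcoeff u z) = monalg.mcoeff u z *: @monalg.mkmalgU M K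
  u 1.
  by apply/monalg.malgP => k; rewrite monalg.mcoeffZ !monalg.mcoeffU mulrnAr mulr1.
have pE : quot_proj (@base_change_relations R M) (monalg.mkmalgU u (monalg.mcoeff u z))
   = monalg.mcoeff u z *: tensor u.
  by rewrite mE; apply/esym/quot_projZ.
have cE' : tofrac (h * d) * monalg.mcoeff u z = tofrac (n * d).
  by rewrite cE !tofracM mulrC mulrA divfK ?tofrac_eq0.
rewrite quot_projD pE tensorD (tensorZ (n * d)) -cE' (tensorZ h) -dE.
by rewrite [LHS]scalerDr !scalerA -tofracM.
Qed.

(** Any element of the extension of scalars has a nonzero multiple in M. *)
Lemma coord_inj (w w' : base_change M) : coord w = coord w' -> w = w'.
Proof.
move=> E; apply/eqP; rewrite -subr_eq0; set w2 := w - w'.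
have w20 : coord w2 = 0 by rewrite /w2 -scaleN1r coordD coordZ E scaleN1r subrr.
have [d [u [d0 dE]]] := base_change_denom w2.
have u0 : u = 0.
  apply: iota_inj; apply/rowP => i; apply/eqP; rewrite iota0 mxE -tofrac_eq0.
  have := congr1 (fun r => coord r 0 i) dE.
  by rewrite /= coordZ w20 scaler0 coord_tensor !mxE => <-.
move/eqP: dE; rewrite u0 tensor0 scaler_eq0 tofrac_eq0 (negPf d0) /=; exact.
Qed.

Lemma has_rank_of_coord (alpha : R) : alpha != 0 ->
  (forall i, exists u, iota u = alpha *: delta_mx 0 i) -> has_rank M e.
Proof.
move=> a0 /choice[b Hb]; have a0' : tofrac alpha != 0 by rewrite tofrac_eq0.
exists (fun i => tensor (b i)) => w.
have E (c : {ffun 'I_e -> K}) i : coord (\sum_i c i *: tensor (b i)) 0 i = c i * tofrac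
  alpha.
  rewrite coord_sum summxE (bigD1 i) //= big1 ?addr0.
    by rewrite coordZ coord_tensor Hb !mxE !eqxx mulr1.
  move=> j ji; rewrite coordZ coord_tensor Hb !mxE eqxx /= (eq_sym i) (negPf ji).
  by rewrite mulr0 tofrac0 mulr0.
exists [ffun i => coord w 0 i / tofrac alpha]; split.
  by apply: coord_inj; apply/rowP => i; rewrite E ffunE divfK.
by move=> c ->; apply/ffunP => i; rewrite ffunE E mulfK.
Qed.

End BaseChange.

(** * Double dual, Fitting ideal and direct sum decompositions *)

Section ReflexiveHull.
Context {R : idomainType} (e : nat) (N : set 'rV[R]_e) (subN : submodule N).
Local Notation M := (submod_type subN).
Variables alpha beta : R.
Hypotheses (alpha0 : alpha != 0) (Nalpha : forall i, N (alpha *: delta_mx 0 i)).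
Hypothesis Nbeta : forall i, N (beta *: delta_mx 0 i).
Hypothesis coprime_ab : forall p q, beta * p = alpha * q -> multiples alpha p.

(** The image of the i-th unit row must be f (alpha e_i) / alpha, which is also
f (beta e_i) / beta; as alpha and beta are coprime, it is in R. *)
Lemma functional_extends (f : dual M) : exists l : 'cV[R]_e, forall u,
  f u = (submod_val u *m l) 0 0.
Proof.
have fD u v : f (u + v) = f u + f v by apply: (raddfD (f : {linear M -> R^o})).
have fZ a u : f (a *: u) = a * f u by apply: (linearZ_LR (f : {linear M -> R^o})).
have f0 : f 0 = 0 by rewrite -[0](scale0r 0) fZ mul0r.
pose ea i := mk_submod subN (Nalpha i); pose eb i := mk_submod subN (Nbeta i).
have /choice[l Hl] i : exists t, f (ea i) = t * alpha.
  apply: (@coprime_ab _ (f (eb i))); rewrite -!fZ; congr (f _).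
  by apply: submod_val_inj; rewrite !submod_valZ !mk_submodK !scalerA mulrC.
exists (\col_i l i) => u; apply: (mulfI alpha0); rewrite -fZ.
have -> : alpha *: u = \sum_i submod_val u 0 i *: ea i.
  apply: submod_val_inj; rewrite submod_valZ {1}[submod_val u]row_sum_delta scaler_sumr.
  rewrite [RHS](big_morph (@submod_val _ _ _ subN) (@submod_valD _ _ _ subN) (submod_val0
    subN)).
  by apply: eq_bigr => i _; rewrite submod_valZ mk_submodK !scalerA mulrC.
rewrite (big_morph (f : M -> R) fD f0) mxE mulr_sumr.
by apply: eq_bigr => i _; rewrite fZ Hl mxE; ring.
Qed.

Lemma functional_unique (l l' : 'cV[R]_e) :
  (forall u : M, (submod_val u *m l) 0 0 = (submod_val u *m l') 0 0) -> l = l'.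
Proof.
move=> E; apply/colP => i; apply: (mulfI alpha0).
have := E (mk_submod subN (Nalpha i)); rewrite mk_submodK -!scalemxAl -!rowE.
by rewrite !mxE.
Qed.

Definition dual_column (f : dual M) : 'cV[R]_e := projT1 (cid (functional_extends f)).
Lemma dual_columnP (f : dual M) u : f u = (submod_val u *m dual_column f) 0 0.
Proof. exact: projT2 (cid (functional_extends f)) u. Qed.

Lemma dual_column_linear a (f g : dual M) : dual_column (a *: f + g) = a *: dual_column f
  + dual_column g.
Proof.
apply: functional_unique => u; rewrite -dual_columnP mulmxDr -scalemxAr mxE [X in _ = X +
  _]mxE -!dual_columnP.
by [].
Qed.

Definition coordinate (i : 'I_e) (u : M) : R^o := submod_val u 0 i.
Lemma coordinate_linear i : linear (coordinate i).
Proof. by move=> a u v; rewrite /coordinate submod_valD submod_valZ !mxE. Qed.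
HB.instance Definition _ i := GRing.isLinear.Build R M R^o _ (coordinate i)
  (coordinate_linear i).
Definition coordinate_dual i : dual M := (coordinate i : {linear M -> R^o}).

(** Evaluation at the row u of the extension of f to R^e; as u varies this
identifies R^e with the double dual of M. *)
Definition evaluation (u : 'rV[R]_e) (f : dual M) : R^o := (u *m dual_column f) 0 0.
Lemma evaluation_linear u : linear (evaluation u).
Proof. by move=> a f g; rewrite /evaluation dual_column_linear mulmxDr -scalemxAr mxE [X
  in X + _]mxE. Qed.
HB.instance Definition _ u := GRing.isLinear.Build R (dual M) R^o _ (evaluation u)
  (evaluation_linear u).
Definition evaluation_dual u : dual (dual M) := (evaluation u : {linear dual M -> R^o}).

Definition bidual_coord (L : dual (dual M)) : 'rV[R]_e := \row_i L (coordinate_dual i).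

Lemma bidual_coordD L L' : bidual_coord (L + L') = bidual_coord L + bidual_coord L'.
Proof. by apply/rowP => i; rewrite !mxE. Qed.
Lemma bidual_coordZ a L : bidual_coord (a *: L) = a *: bidual_coord L.
Proof. by apply/rowP => i; rewrite !mxE. Qed.

Lemma dual_decomp (f : dual M) : f = \sum_i dual_column f i 0 *: coordinate_dual i.
Proof.
apply: dualP => u; rewrite [LHS]dual_columnP mxE.
transitivity (\sum_i (dual_column f i 0 *: coordinate_dual i) u).
  by apply: eq_bigr => i _; rewrite mulrC.
by apply/esym; apply: (big_morph (fun f : dual M => f u : R)).
Qed.

Lemma bidual_coordK L : evaluation_dual (bidual_coord L) = L.
Proof.
apply: dualP => f; rewrite [f in RHS]dual_decomp.
have -> : L (\sum_i dual_column f i 0 *: coordinate_dual i) = \sum_i L (dual_column f i 0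
  *: coordinate_dual i).
  by apply: (raddf_sum (L : {linear dual M -> R^o})).
rewrite /evaluation_dual /= /dual_fun /= /evaluation mxE; apply: eq_bigr => i _.
by rewrite mxE mulrC; apply/esym/(linearZ_LR (L : {linear dual M -> R^o})).
Qed.

Lemma dual_column_coordinate i : dual_column (coordinate_dual i) = delta_mx i 0.
Proof.
apply: functional_unique => u; rewrite -dual_columnP -colE mxE.
by [].
Qed.

Lemma evaluation_dualK u : bidual_coord (evaluation_dual u) = u.
Proof.
apply/rowP => i; rewrite mxE /evaluation_dual /dual_fun /= /evaluation
  dual_column_coordinate -colE mxE.
by [].
Qed.

Lemma bidual_coord_bidual u : bidual_coord (bidual u) = submod_val u.
Proof. by apply/rowP => i; rewrite mxE. Qed.

Lemma bidual_coord_inj L L' : bidual_coord L = bidual_coord L' -> L = L'.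
Proof. by move=> E; rewrite -[L]bidual_coordK E bidual_coordK. Qed.

Lemma bidual_range_submodule : submodule (range (@bidual R M)).
Proof.
apply/submoduleP; split.
- by exists 0 => //; apply: bidual_coord_inj;
  rewrite bidual_coord_bidual -[0 in RHS](scale0r 0) bidual_coordZ scale0r.
- move=> _ _ [u _ <-] [v _ <-]; exists (u + v) => //; apply: bidual_coord_inj.
  by rewrite bidual_coordD !bidual_coord_bidual.
- move=> a _ [u _ <-]; exists (a *: u) => //; apply: bidual_coord_inj.
  by rewrite bidual_coordZ !bidual_coord_bidual.
Qed.

Lemma bidual_rangeP L : range (@bidual R M) L <-> N (bidual_coord L).
Proof.
split=> [[u _ <-]|NL]; first by rewrite bidual_coord_bidual; apply: submod_val_mem.
exists (mk_submod subN NL) => //; apply: bidual_coord_inj.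
by rewrite bidual_coord_bidual.
Qed.

Local Notation Q := (quotmod (range (@bidual R M))).
Local Notation proj := (quot_proj (range (@bidual R M))).

Lemma proj_eq0 L : proj L = 0 <-> N (bidual_coord L).
Proof.
have spanE := span_id bidual_range_submodule.
have proj0 : proj 0 = 0 by apply: raddf0.
rewrite -bidual_rangeP -proj0 quot_projP subr0; split=> [/set_mem|rL]; first
  by rewrite spanE.
by apply: mem_set; rewrite spanE.
Qed.

Lemma proj_sumZ k (c : 'I_k -> R) (G : 'I_k -> dual (dual M)) :
  \sum_j c j *: proj (G j) = proj (\sum_j c j *: G j).
Proof.
rewrite [RHS]raddf_sum; apply: eq_bigr => j _; exact: quot_projZ.
Qed.

Lemma bidual_coord_sumZ k (c : 'I_k -> R) (G : 'I_k -> dual (dual M)) :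
  bidual_coord (\sum_j c j *: G j) = \sum_j c j *: bidual_coord (G j).
Proof.
rewrite (big_morph bidual_coord bidual_coordD (id1 := 0)).
  by apply: eq_bigr => j _; rewrite bidual_coordZ.
by rewrite -[0 in LHS](scale0r 0) bidual_coordZ scale0r.
Qed.

Variable I : set R.
Hypothesis idI : ideal I.
Hypothesis detI : forall A : 'M[R]_e, (forall i, N (row i A)) -> I (\det A).
Hypothesis genI : I `<=` ideal_gen [set \det A | A in [set A : 'M[R]_e | forall i,
  N (row i A)]].

(** Expand along the first k columns. *)
Lemma block_det_mem k (X : 'M[R]_(k + e)) :
  (forall i, N (\row_j X i (rshift k j))) -> I (\det X).
Proof.
elim: k X => [|k IHk] X NX.
  apply: detI => i; have := NX i; congr N; apply/rowP => j; rewrite !mxE; congr (X _ _).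
  exact: val_inj.
rewrite (expand_det_col X ord0); apply: ideal_sum => // i _; apply: idealMl => //.
rewrite /cofactor; apply: idealMl => //; apply: (IHk (row' i (col' ord0 X))) => i'.
have := NX (lift i i'); congr N; apply/rowP => j; rewrite !mxE; congr (X _ _).
exact: val_inj.
Qed.

(** Let T be a square matrix of relations between generators g_j, with
g_j = B_j modulo M and e_i = C_i g.  The matrix of relations
((T, 0), (-C, 1)) between the g_j and the e_i has the same determinant; the
change of generators from g_j to g_j - B_j, which are zero, makes its last e
columns consist of rows of M. *)
Lemma ideal_of_submod : ideal_of_module M = I.
Proof.
apply/seteqP; split=> [c [k [g [spang]]]|c /genI Ic].
  apply: ideal_gen_min => // _ [T /= relT <-].
  have /choice[G HG] j : exists L, proj L = g j.
    by move: (g j); apply: quot_projW => L; exists L.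
  have /choice[C HC] i : exists c : 'I_k -> R,
    proj (evaluation_dual (delta_mx 0 i)) = \sum_j c j *: g j.
    by apply: span_range; rewrite spang.
  pose B := \matrix_(j, i) bidual_coord (G j) 0 i.
  have rowB j : row j B = bidual_coord (G j) by apply/rowP => i; rewrite !mxE.
  pose Cm := \matrix_(i, j) C i j.
  pose X := block_mx T (T *m B) (- Cm) (1%:M - Cm *m B).
  have detX : \det X = \det T.
    have -> : X = block_mx T 0 (- Cm) 1%:M *m block_mx 1%:M B 0 1%:M.
      by rewrite mulmx_block !(mulmx1, mulmx0, mul0mx, addr0, add0r) mulNmx [- _ + _]addrC.
    by rewrite det_mulmx det_lblock det_ublock !det1 !mulr1.
  rewrite -detX; apply: block_det_mem => i; case: (split_ordP i) => i' ->.
    have -> : \row_j X (lshift e i') (rshift k j) = bidual_coord (\sum_j T i' j *: G j).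
      rewrite bidual_coord_sumZ; apply/rowP => j; rewrite mxE block_mxEur mxE summxE.
      by apply: eq_bigr => l _; rewrite !mxE.
    apply/proj_eq0; rewrite -proj_sumZ; apply: etrans (relT i').
    by apply: eq_bigr => j _; rewrite HG.
  have -> : \row_j X (rshift k i') (rshift k j) =
     bidual_coord (evaluation_dual (delta_mx 0 i') + (-1) *: \sum_j C i' j *: G j).
    rewrite bidual_coordD bidual_coordZ bidual_coord_sumZ evaluation_dualK scaleN1r.
    apply/rowP => j; rewrite mxE block_mxEdr !mxE summxE eqxx /= eq_sym; congr (_ - _).
    by apply: eq_bigr => l _; rewrite !mxE.
  apply/proj_eq0; rewrite quot_projD -[proj (_ *: _)]quot_projZ -[quotmod_scale _ _]/(_
    *: proj _) -proj_sumZ HC.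
  rewrite scaleN1r -sumrB big1 // => j _; by rewrite HG subrr.
exists e, (fun i => proj (evaluation_dual (delta_mx 0 i))); split.
  apply/seteqP; split=> // q _; move: q; apply: quot_projW => L.
  have -> : L = \sum_i bidual_coord L 0 i *: evaluation_dual (delta_mx 0 i).
    apply: bidual_coord_inj; rewrite bidual_coord_sumZ {1}[bidual_coord L]row_sum_delta.
    by apply: eq_bigr => i _; rewrite evaluation_dualK.
  have sp := span_submodule (range (fun i => proj (evaluation_dual (delta_mx 0 i)))).
  rewrite -proj_sumZ; apply: (submod_sum sp) => i _; apply: (submodZ sp).
  by apply: span_sub; exists i.
move: c Ic; apply: ideal_gen_mono => _ [A /= NA <-]; exists A => //= i.
rewrite proj_sumZ; apply/proj_eq0; rewrite bidual_coord_sumZ.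
have := NA i; congr N; rewrite [LHS]row_sum_delta; apply: eq_bigr => j _.
by rewrite mxE evaluation_dualK.
Qed.

Hypothesis e_gt0 : (0 < e)%N.
Hypothesis idempotent_trivial : forall E : 'M[R]_e, E *m E = E ->
  (forall u, N u -> N (u *m E)) -> E = 0 \/ E = 1%:M.

(** A decomposition of M is given by a projection of M onto a summand, which
extends to R^e as an idempotent matrix. *)
Lemma submod_indecomposable : indecomposable M.
Proof.
split.
  move=> M0; have : [set: M] (mk_submod subN (Nalpha (Ordinal e_gt0))) by [].
  rewrite M0 /= => /(congr1 (fun u : M => submod_val u 0 (Ordinal e_gt0))).
  rewrite mk_submodK submod_val0 !mxE !eqxx mulr1 => /eqP; by rewrite (negPf alpha0).
move=> A B sA sB AB0 ABM.
have AB u : A u -> B u -> u = 0 by move=> Au Bu; have : (A `&` B) u by []; rewrite AB0.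
have /choice[p Hp] (u : M) : exists a, A a /\ B (u - a).
  have [|a [b [Aa Bb ->]]] := @span_setU _ _ A B u sA sB; first by rewrite ABM.
  by exists a; rewrite addrAC subrr add0r.
have p_uniq u a : A a -> B (u - a) -> a = p u.
  move=> Aa Ba; apply/eqP; rewrite -subr_eq0; apply/eqP; have [Ap Bp] := Hp u.
  apply: AB; first exact: submodB.
  have -> : a - p u = (u - p u) - (u - a) by rewrite opprB [RHS]addrC addrA subrK.
  exact: submodB.
have p_linear : linear p.
  move=> c u v; apply/esym/p_uniq; have [Au Bu] := Hp u; have [Av Bv] := Hp v.
    by apply: submodD => //; apply: submodZ.
  have -> : c *: u + v - (c *: p u + p v) = c *: (u - p u) + (v - p v).
    by rewrite scalerBr opprD addrACA.
  by apply: submodD => //; apply: submodZ.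
have /choice[l Hl] i : exists l : 'cV[R]_e, forall u,
  submod_val (p u) 0 i = (submod_val u *m l) 0 0.
  pose h (u : M) : R^o := submod_val (p u) 0 i.
  have h_linear : linear h by move=> c u v;
    rewrite /h p_linear submod_valD submod_valZ !mxE.
  pose hL := HB.pack_for {linear M -> R^o} h (GRing.isLinear.Build R M R^o _ h h_linear).
  by have [l Hl'] := functional_extends (hL : dual M); exists l => u; rewrite -Hl'.
pose E := \matrix_(j, i) l i j 0.
have HE u : submod_val (p u) = submod_val u *m E.
  by apply/rowP => i; rewrite Hl !mxE; apply: eq_bigr => j _; rewrite mxE.
have pp u : p (p u) = p u.
  have [Ap Bp] := Hp u; apply/esym/p_uniq => //; rewrite subrr; exact: submod0.
have [||E0|E1] := idempotent_trivial (E := E).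
- apply/row_matrixP => i; apply/rowP => j; apply: (mulfI alpha0).
  have := congr1 (fun u : M => submod_val u 0 j) (pp (mk_submod subN (Nalpha i))).
  rewrite /= !HE mk_submodK -mulmxA -!scalemxAl -!rowE.
  by clear HE; move: E (E *m E) => E' E2; rewrite !mxE.
- by move=> u Nu; rewrite -[u](mk_submodK subN Nu) -HE; apply: submod_val_mem.
- left; apply/seteqP; split=> [a Aa|_ ->]; last exact: submod0.
  have -> : a = p a by apply: p_uniq => //; rewrite subrr; apply: submod0.
  by apply: submod_val_inj; rewrite HE E0 mulmx0.
- right; apply/seteqP; split=> [b Bb|_ ->]; last exact: submod0.
  have pb : 0 = p b by apply: p_uniq; [apply: submod0|rewrite subr0].
  by apply: submod_val_inj; rewrite -[submod_val b]mulmx1 -E1 -HE -pb.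
Qed.

End ReflexiveHull.

(** * Integral closure of a module of rows *)

Section DvrRing.
Context {K : fieldType} (V : set K).
Hypothesis dvrV : dvr_of V.

Lemma dvr_0 : V 0.
Proof. by case: dvrV => v _ ->; left. Qed.
Lemma dvr_D a b : V a -> V b -> V (a + b).
Proof.
case: dvrV => v [_ vD _] -> /= [->|av]; first by rewrite add0r.
move=> [->|bv]; first by rewrite addr0; right.
have [->|a0] := eqVneq a 0; first by rewrite add0r; right.
have [->|b0] := eqVneq b 0; first by rewrite addr0; right.
have [|ab0] := eqVneq (a + b) 0; [by left | right].
by apply: le_trans (vD _ _ a0 b0 ab0); rewrite le_min av.
Qed.
Lemma dvr_M a b : V a -> V b -> V (a * b).
Proof.
case: dvrV => v [vM _ _] -> /= [->|av]; first by rewrite mul0r; left.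
move=> [->|bv]; first by rewrite mulr0; left.
have [->|a0] := eqVneq a 0; first by rewrite mul0r; left.
have [->|b0] := eqVneq b 0; first by rewrite mulr0; left.
by right; rewrite vM // addr_ge0.
Qed.
Lemma dvr_sum (T : Type) (r : seq T) (F : T -> K) :
  (forall i, V (F i)) -> V (\sum_(i <- r) F i).
Proof. by move=> VF; elim/big_rec: _ => [|i u _ Vu]; [exact: dvr_0|apply: dvr_D]. Qed.
End DvrRing.

(** The expansion behind the Cauchy-Binet formula, before the functions f with
the same image are collected. *)
Lemma det_mulmx_expand (F : comNzRingType) n g (C : 'M[F]_(n, g)) (B : 'M[F]_(g, n)) :
  \det (C *m B) = \sum_(f : {ffun 'I_n -> 'I_g}) (\prod_i C i (f i)) * \det (rowsub f B).
Proof.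
rewrite /determinant.
under eq_bigr => s _.
  under eq_bigr => i _ do rewrite mxE.
  rewrite bigA_distr_bigA /= mulr_sumr.
  over.
rewrite exchange_big /=; apply: eq_bigr => f _; rewrite mulr_sumr; apply: eq_bigr => s _.
rewrite big_split /= mulrCA; congr (_ * (_ * _)).
by apply: eq_bigr => i _; rewrite mxE.
Qed.

Section IntegralClosure.
Context {R : idomainType} (g e : nat) (G : 'M[R]_(g, e)) (I : set R).
Local Notation K := {fraction R}.
Local Notation toK := (map_mx (@tofrac R)).

Hypothesis normalR : forall z : K,
  (forall V : set K, dvr_of V -> range (@tofrac R) `<=` V -> V z) -> exists c, z = tofrac c.
Hypothesis idI : ideal I.
Hypothesis criterionI : forall c : R,
  (forall V : set K, dvr_of V -> range (@tofrac R) `<=` V ->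
     forall J : set K, J 0 -> (forall u v, J u -> J v -> J (u + v)) ->
       (forall c u, V c -> J u -> J (c * u)) ->
       (forall h, I h -> J (tofrac h)) -> J (tofrac c)) -> I c.
Hypothesis minorI : forall f : 'I_e -> 'I_g, I (\det (rowsub f G)).
Hypothesis I_minor : I `<=` ideal_gen (range (fun f : 'I_e -> 'I_g => \det (rowsub f G))).

Definition row_extension (V : set K) : set 'rV[K]_e :=
  [set w | exists2 c : 'rV[K]_g, (forall i, V (c 0 i)) & w = c *m toK G].

Definition closure_rows : set 'rV[R]_e :=
  [set u | forall V : set K, dvr_of V -> range (@tofrac R) `<=` V ->
    row_extension V (toK u)].

Section OneDvr.
Variable V : set K.
Hypotheses (dvrV : dvr_of V) (RV : range (@tofrac R) `<=` V).

Lemma row_extension0 : row_extension V 0.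
Proof. by exists 0; rewrite ?mul0mx // => i; rewrite mxE; apply: dvr_0. Qed.
Lemma row_extensionD u v : row_extension V u -> row_extension V v ->
  row_extension V (u + v).
Proof.
move=> [c Vc ->] [d Vd ->]; exists (c + d); last by rewrite mulmxDl.
by move=> i; rewrite mxE; apply: dvr_D.
Qed.
Lemma row_extensionZ a u : V a -> row_extension V u -> row_extension V (a *: u).
Proof.
move=> Va [c Vc ->]; exists (a *: c); last by rewrite scalemxAl.
by move=> i; rewrite mxE; apply: dvr_M.
Qed.
Lemma row_extension_sum (n : nat) (c : 'I_n -> K) (F : 'I_n -> 'rV[K]_e) :
  (forall i, V (c i)) -> (forall i, row_extension V (F i)) ->
    row_extension V (\sum_i c i *: F i).
Proof.
move=> Vc VF; elim/big_rec: _ => [|i u _ Vu]; first exact: row_extension0.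
by apply: row_extensionD => //; apply: row_extensionZ.
Qed.
End OneDvr.

Lemma closure_rows_submodule : submodule closure_rows.
Proof.
apply/submoduleP; split.
- by move=> V dvrV RV; rewrite map_mx0; apply: row_extension0.
- by move=> u v Nu Nv V dvrV RV; rewrite map_mxD; apply: row_extensionD => //;
  [apply: Nu|apply: Nv].
- move=> a u Nu V dvrV RV; rewrite map_mxZ; apply: row_extensionZ => //; last exact: Nu.
  by apply: RV; exists a.
Qed.

Lemma closure_rows_row i : closure_rows (row i G).
Proof.
move=> V dvrV RV; exists (delta_mx 0 i); last by rewrite map_row rowE.
by move=> j; rewrite mxE; case: (_ && _); apply: RV; [exists 1;
  rewrite ?tofrac1|exists 0; rewrite ?tofrac0].
Qed.

Local Notation N := closure_rows.
Local Notation M := (submod_type closure_rows_submodule).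

Local Notation val := (@submod_val _ _ _ closure_rows_submodule).
Lemma val_linear : linear val.
Proof. by []. Qed.

Lemma closure_rows_integrally_closed : integrally_closed M.
Proof.
apply/seteqP; split=> [f Vf|_ [u _ <-] V dvrV RV]; last first.
  exists 1%N, (fun=> 1), (fun=> u); split; last by rewrite big_ord1 scale1r.
  by move=> _; apply: RV; exists 1; rewrite ?tofrac1.
have fV V : dvr_of V -> range (@tofrac R) `<=` V -> row_extension V (coord val f).
  move=> dvrV RV; have [n [c [u [Vc ->]]]] := Vf V dvrV RV.
  rewrite (coord_sum val_linear); under eq_bigr => i _ do rewrite (coordZ val_linear)
    (coord_tensor val_linear).
  by apply: row_extension_sum => // i; apply: (submod_val_mem (u i)).
have /choice[h Hh] i : exists c, coord val f 0 i = tofrac c.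
  apply: normalR => V dvrV RV; have [c Vc ->] := fV V dvrV RV.
  rewrite mxE; apply: dvr_sum => // j; apply: dvr_M => //; rewrite mxE.
  by apply: RV; exists (G j i).
pose u : 'rV[R]_e := \row_i h i.
have uE : toK u = coord val f by apply/rowP => i; rewrite Hh [LHS]mxE [u _ _]mxE.
have Nu : N u by move=> V dvrV RV; rewrite uE; apply: fV.
exists (mk_submod _ Nu) => //; apply: (coord_inj val_linear (@submod_val_inj _ _ _ _)).
by rewrite (coord_tensor val_linear) mk_submodK.
Qed.

(** Over each V the rows of A are combinations of the rows of G, so the
determinant of A is a combination of the maximal minors of G. *)
Lemma closure_rows_det (A : 'M[R]_e) : (forall i, N (row i A)) -> I (\det A).
Proof.
move=> NA; apply: criterionI => V dvrV RV J J0 JD JZ IJ.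
have /choice[C HC] i : exists c : 'rV[K]_g, (forall j,
  V (c 0 j)) /\ toK (row i A) = c *m toK G.
  by have [c] := NA i V dvrV RV; exists c.
have AE : toK A = (\matrix_i C i) *m toK G.
  by apply/row_matrixP => i; rewrite row_mul rowK -map_row; case: (HC i).
rewrite -det_map_mx AE det_mulmx_expand.
elim/big_rec: _ => // f z _ Jz; apply: JD => //; apply: JZ.
  elim/big_rec: _ => [|i w _ Vw]; first by apply: RV; exists 1; rewrite ?tofrac1.
  by apply: dvr_M => //; rewrite mxE; case: (HC i).
have -> : rowsub f (toK G) = toK (rowsub f G) by apply/matrixP => i j; rewrite !mxE.
by rewrite det_map_mx; apply: IJ; apply: minorI.
Qed.

Lemma closure_rows_det_gen :
  I `<=` ideal_gen [set \det A | A in [set A : 'M[R]_e | forall i, N (row i A)]].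
Proof.
apply: subset_trans I_minor _; apply: ideal_gen_mono => _ [f _ <-].
exists (rowsub f G) => //= i.
have -> : row i (rowsub f G) = row (f i) G by apply/rowP => j; rewrite !mxE.
exact: closure_rows_row.
Qed.

(** Cramer's rule. *)
Lemma closure_rows_scale c i : I c -> N (c *: delta_mx 0 i).
Proof.
have sN := closure_rows_submodule.
pose J := [set c | N (c *: delta_mx 0 i)].
have idJ : ideal J.
  apply/idealP; rewrite /J /=; split=> [|u v Ju Jv|a u Ju]; rewrite /=.
  - by rewrite scale0r; apply: (submod0 sN).
  - by rewrite scalerDl; apply: (submodD sN).
  - by rewrite -scalerA; apply: (submodZ sN).
move=> /I_minor; move: c; apply: (ideal_gen_min idJ) => _ [f _ <-]; rewrite /J /=.
have -> : \det (rowsub f G) *: delta_mx 0 i = \sum_j (\adj (rowsub f G)) i j *: row (f j) G.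
  rewrite -[delta_mx 0 i]mulmx1 scalemxAr scale_scalar_mx mulr1 -mul_adj_mx mulmxA -rowE.
  rewrite mulmx_sum_row; apply: eq_bigr => j _; congr (_ *: _); first by rewrite mxE.
  by apply/rowP => l; rewrite !mxE.
by apply: (submod_sum sN) => j _; apply: (submodZ sN); apply: closure_rows_row.
Qed.

End IntegralClosure.

(** * The generators of the module *)

Lemma decreasing_ge r (a : nat -> nat) i : (forall i, (i < r)%N -> (a i.+1 < a i)%N) ->
  (i <= r)%N -> (r - i <= a i)%N.
Proof.
move=> adec ir; rewrite -{2}(subKn ir); elim: (r - i)%N (leq_subr i r) => [//|n IHn] nr.
have := adec (r - n.+1)%N; have := IHn (ltnW nr).
rewrite (_ : (r - n.+1).+1 = r - n)%N; lia.
Qed.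

Lemma increasing_ge r (b : nat -> nat) i : (forall i, (i < r)%N -> (b i < b i.+1)%N) ->
  (i <= r)%N -> (i <= b i)%N.
Proof.
move=> binc; elim: i => // i IHi ir; apply: leq_ltn_trans (binc _ ir).
by apply: IHi; apply: ltnW.
Qed.

Section Generators.
Context {R : idomainType} (x y : R) (r e1 : nat) (a b : nat -> nat).
Local Notation e := e1.+1.
Hypotheses (e1_gt0 : (0 < e1)%N) (e_le_r : (e <= r)%N).
Hypotheses (ar : a r = 0%N) (b0 : b 0%N = 0%N).
Hypotheses (adec : forall i, (i < r)%N -> (a i.+1 < a i)%N)
           (binc : forall i, (i < r)%N -> (b i < b i.+1)%N).
Hypothesis a_tail : a (r - e + 2)%N = (e - 2)%N.
Local Notation I := (monomial_ideal x y r a b).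

Lemma a_tail_eq n : (n <= e1.-1)%N -> a (r - n)%N = n.
Proof.
move=> ne; apply/eqP; rewrite eqn_leq; apply/andP; split; last by have :=
  decreasing_ge adec (leq_subr n r); lia.
have gap i j : (i <= j <= r)%N -> (a j + (j - i) <= a i)%N.
  elim: j => [|j IHj]; first by rewrite leqn0 andbT => /eqP->; lia.
  case/andP; rewrite leq_eqVlt => /orP[/eqP->|ij jr]; first lia.
  have := adec jr; have : (i <= j <= r)%N by lia.
  move/IHj; lia.
have := gap (r - e + 2)%N (r - n)%N; rewrite a_tail; lia.
Qed.

Lemma b_pred_lt n : (n < r)%N -> (b (r - n.+1) < b (r - n))%N.
Proof. by move=> nr; have := binc (i := r - n.+1); rewrite (_ : (r - n.+1).+1 = r - n)%N;
  lia. Qed.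

Lemma b_one_le i : (0 < i <= r)%N -> (b 1 <= b i)%N.
Proof.
elim: i => // -[//|i] IHi ir; apply: leq_trans (ltnW (binc (i := i.+1) _)); last lia.
apply: IHi; lia.
Qed.

(** Columns are numbered from 0 to e1 = e - 1.  The last e1 generators of I, whose
exponents of x are e1 - 1, ..., 1, 0, go to the column with this number, and all
other generators to the last column. *)
Definition gen_col i := if (i <= r - e1)%N then e1 else (r - i)%N.
Definition gen_entry i : R :=
  if (i <= r - e1)%N then x ^+ (a i - e1) * y ^+ b i else y ^+ (b i - (e1 - (r - i))).

Lemma gen_col_le i : (gen_col i <= e1)%N.
Proof. by rewrite /gen_col; case: ifP => //; lia. Qed.

Lemma gen_entry_mul i : (i <= r)%N ->
  x ^+ gen_col i * y ^+ (e1 - gen_col i) * gen_entry i = x ^+ a i * y ^+ b i.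
Proof.
move=> ir; rewrite /gen_col /gen_entry; case: ifPn => ie.
  rewrite subnn expr0 mulr1 mulrA -exprD subnKC //; have := decreasing_ge adec ir; lia.
rewrite -mulrA -exprD subnKC; last by have := increasing_ge binc ir; lia.
suff -> : a i = (r - i)%N by []. rewrite -{1}(subKn ir) a_tail_eq //; lia.
Qed.

(** The entries ent k are read along a diagonal; isX k tells that the entry in
column k is the x of the k-th band row, in which case the y of this row cannot
occur in column k+1.  As long as only x has been met the product is x^k.  Once a
single entry row has been met, the product x^n y^t satisfies
b_(r-n) <= t + (e - k): even if only factors x or y remain, it ends in I. *)
Lemma gen_product (ent : nat -> R) (isX : nat -> bool) :
  (forall k, (k <= e1)%N ->
    [\/ [/\ isX k, (k < e1)%N & ent k = x],
        [/\ ~~ isX k, (0 < k)%N, ~~ isX k.-1 & ent k = y] |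
        ~~ isX k /\ exists i, [/\ (i <= r)%N, gen_col i = k & ent k = gen_entry i]]) ->
  I (\prod_(k < e) ent k).
Proof.
move=> Hent.
have inv k : (k <= e1)%N ->
   ((forall i, (i < k)%N -> isX i) /\ \prod_(i < k) ent i = x ^+ k) \/
   exists n t, [/\ \prod_(i < k) ent i = x ^+ n * y ^+ t,
     (n < k)%N & (b (r - n) <= t + (e - k))%N].
  elim: k => [|k IHk] ke; first by left; split=> //; rewrite big_ord0.
  rewrite big_ord_recr /=; case: (Hent k (ltnW ke)) => [[Xk _ ->]|[nX k0 nXp ->]|[nX [i
    [ir kapk ->]]]].
  - case: (IHk (ltnW ke)) => [[allX ->]|[n [t [-> nk le_t]]]].
      by left; split; [move=> i; rewrite ltnS leq_eqVlt => /orP[/eqP->|/allX]|rewrite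
        exprSr].
    right; exists n.+1, t; split; [by rewrite exprSr; ring|by []|].
    have := b_pred_lt (n := n); lia.
  - case: (IHk (ltnW ke)) => [[allX _]|[n [t [-> nk le_t]]]].
      by case/negP: nXp; apply: allX; rewrite prednK.
    right; exists n, t.+1; split; [by rewrite exprSr mulrA|lia|lia].
  - have ie : (i <= r - e1)%N = false by apply/negbTE; move: kapk; rewrite /gen_col;
    case: ifP => //; lia.
    have {kapk} ik : i = (r - k)%N by move: kapk; rewrite /gen_col ie; lia.
    rewrite /gen_entry ie ik subKn; last lia.
    case: (IHk (ltnW ke)) => [[allX ->]|[n [t [-> nk le_t]]]].
      right; exists k, (b (r - k) - (e1 - k))%N; split=> //; lia.
    right; exists n, (t + (b (r - k) - (e1 - k)))%N; split; [by rewrite exprD mulrA|lia|].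
    have := increasing_ge binc (leq_subr k r); lia.
rewrite big_ord_recr /=; case: (Hent e1 (leqnn _)) => [[_ /[!ltnn]//]|[nX k0 nXp ->]|[nX
  [i [ir kapk ->]]]].
  case: (inv e1 (leqnn _)) => [[allX _]|[n [t [-> nk le_t]]]].
    by case/negP: nXp; apply: allX; rewrite prednK.
  rewrite -mulrA -exprSr; apply: (@monomial_ideal_mem _ x y r a b (r - n));
    rewrite ?a_tail_eq; lia.
have ie : (i <= r - e1)%N by move: kapk; rewrite /gen_col; case: ifP => //; lia.
case: (inv e1 (leqnn _)) => [[allX ->]|[n [t [-> nk le_t]]]].
  rewrite -[x ^+ e1]mulr1 -(expr0 y) -(subnn e1) -{1 3}kapk gen_entry_mul //.
  by apply: ideal_gen_sub; exists i.
rewrite /gen_entry ie.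
have -> : x ^+ n * y ^+ t * (x ^+ (a i - e1) * y ^+ b i) = x ^+ (n + (a i - e1)) * y ^+
  (t + b i).
  by rewrite !exprD; ring.
have [i0|i_gt0] := posnP i; last first.
  apply: (@monomial_ideal_mem _ x y r a b (r - n)); rewrite ?a_tail_eq; try lia.
  have := increasing_ge binc ir; lia.
have a0 := decreasing_ge adec (leq0n r); rewrite i0 b0 addn0.
(* the last entry is a pure power x^(a_0 - e1), so one factor y may be lacking:
   the additional factor x leads to another step of the staircase, or to the
   generator of index 1 if n is maximal *)
have [n_lt|n_ge] := ltnP n.+1 e1.
  apply: (@monomial_ideal_mem _ x y r a b (r - n.+1)); rewrite ?a_tail_eq; try lia.
  have := b_pred_lt (n := n); lia.
apply: (@monomial_ideal_mem _ x y r a b 1); first lia.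
  have := adec (i := 0); lia.
have := b_pred_lt (n := n); have := b_one_le (i := r - n.+1); lia.
Qed.

Definition band : 'M[R]_(e1, e) :=
  \matrix_(j, k) (if k == j :> nat then x else if k == j.+1 :> nat then y else 0).
Definition gen_rows : 'M[R]_(r.+1, e) :=
  \matrix_(i, k) (if k == gen_col i :> nat then gen_entry i else 0).
Definition generators : 'M[R]_(e1 + r.+1, e) := col_mx band gen_rows.

(** At most one of the two nonzero entries of a band row occurs, because h is
injective. *)
Lemma generators_product (h : 'I_e -> 'I_(e1 + r.+1)) : injective h ->
  I (\prod_k generators (h k) k).
Proof.
move=> h_inj; have idI : ideal I by apply: monomial_ideal_ideal.
have [[k k0]|nz] := pselect (exists k, generators (h k) k = 0).
  by rewrite (bigD1 k) //= k0 mul0r; apply: ideal0.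
pose ent n := if insub n is Some k then generators (h k) k else 0.
pose isX n := if (insub n : option 'I_e) is Some k then (h k == n :> nat) && (n < e1)%N
  else false.
have entE (k : 'I_e) : ent k = generators (h k) k by rewrite /ent valK.
have isXE (k : 'I_e) : isX k = (h k == k :> nat) && (k < e1)%N by rewrite /isX valK.
rewrite (eq_bigr (fun k : 'I_e => ent k)); last by move=> k _; rewrite entE.
apply: (@gen_product ent isX) => n ne1.
pose k : 'I_e := Ordinal (ne1 : (n < e)%N); rewrite -[n]/(k : nat) isXE entE.
have : generators (h k) k <> 0 by move=> k0; apply: nz; exists k.
case: (split_ordP (h k)) => j hk; rewrite hk ?col_mxEu ?col_mxEd mxE /=.
  case: eqP => [kj _|_].
    have lt_k : (n < e1)%N by rewrite kj; apply: ltn_ord.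
    by constructor 1; split=> //=; rewrite lt_k andbT; apply/eqP; rewrite /= kj.
  case: eqP => // kj _; constructor 2; split=> //.
  - by rewrite negb_and kj; apply/orP; left; apply/eqP => /=; lia.
  - by rewrite kj.
  - have lt_j : (j < e)%N by rewrite ltnS ltnW.
    rewrite kj /= (isXE (Ordinal lt_j)) /=; apply/negP => /andP[/eqP hj _].
    have : Ordinal lt_j = k by apply: h_inj; apply: val_inj; rewrite /= hj hk.
    by move/(congr1 val); rewrite /= kj; lia.
case: eqP => // kj _; constructor 3; split.
  by rewrite negb_and -implybE; apply/implyP => /eqP /=; lia.
by exists j; split=> //; rewrite -ltnS.
Qed.

Lemma generators_minor (h : 'I_e -> 'I_(e1 + r.+1)) : I (\det (rowsub h generators)).
Proof.
have idI : ideal I by apply: monomial_ideal_ideal.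
have [/injectiveP h_inj|/injectivePn[k1 [k2 k12 eqh]]] := boolP (injectiveb h); last first.
  rewrite (determinant_alternate k12); first exact: ideal0.
  by move=> j; rewrite !mxE eqh.
apply: (ideal_sum idI) => s _; apply: (idealMl idI).
rewrite (reindex_inj (@perm_inj _ s^-1)) /=.
have -> : \prod_i rowsub h generators (s^-1%g i) (s (s^-1%g i)) = \prod_i generators (h
  (s^-1%g i)) i.
  by apply: eq_bigr => i _; rewrite mxE permKV.
by apply: generators_product => i j /h_inj /perm_inj.
Qed.

Definition band_with (v : 'rV[R]_e) : 'M[R]_e :=
  \matrix_(l, k) (if insub (l : nat) is Some j then band j k else v 0 k).

Lemma band_with_last v k : band_with v ord_max k = v 0 k.
Proof. by rewrite mxE insubF ?ltnn. Qed.

Lemma band_with_band v (l : 'I_e) (j : 'I_e1) k : l = j :> nat ->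
  band_with v l k = band j k.
Proof. by move=> lj; rewrite mxE lj valK. Qed.

Definition band_cofactor k := cofactor (band_with 0) ord_max k.

Lemma det_band_with v : \det (band_with v) = \sum_k v 0 k * band_cofactor k.
Proof.
rewrite (expand_det_row _ ord_max); apply: eq_bigr => k _.
rewrite band_with_last; congr (_ * (_ * \det _)).
apply/matrixP => i j; rewrite !mxE.
have lt_i : (lift ord_max i < e1)%N by rewrite lift_max.
by rewrite !insubT.
Qed.

(** The first cofactor is the determinant of a triangular matrix with diagonal
y; the next ones follow since completing the band by its own k-th row gives
determinant 0, that is, x C_k + y C_(k+1) = 0. *)
Lemma band_cofactorE (k : 'I_e) : y != 0 ->
  band_cofactor k = (-1) ^+ (e1 + k) * (x ^+ k * y ^+ (e1 - k)).
Proof.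
move=> y_neq0; case: k => k; elim: k => [|k IHk] ke.
  rewrite /band_cofactor /cofactor /= addn0 expr0 mul1r subn0; congr (_ * _).
  rewrite det_trig.
    rewrite (eq_bigr (fun=> y)) ?prodr_const ?card_ord // => i _; rewrite !mxE.
    have lt_i : (lift ord_max i < e1)%N by rewrite lift_max.
    by rewrite insubT mxE /= /bump (leqNgt e1) ltn_ord add0n add1n gtn_eqF // eqxx.
  apply/is_trig_mxP => i j ij; rewrite !mxE.
  have lt_i : (lift ord_max i < e1)%N by rewrite lift_max.
  rewrite insubT mxE /= /bump (leqNgt e1) ltn_ord add0n add1n eqSS.
  by rewrite !gtn_eqF // leqW.
have lt_k : (k < e1)%N by [].
pose j := Ordinal lt_k.
have det0 : \det (band_with (row j band)) = 0.
  have ne : (widen_ord (leqnSn e1) j) != ord_max by rewrite -val_eqE /= ltn_eqF.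
  apply: (determinant_alternate ne) => l; rewrite band_with_last [RHS]mxE.
  exact: band_with_band.
move: det0; rewrite det_band_with (bigD1 (Ordinal (ltnW ke : (k < e)%N))) //= (bigD1
  (Ordinal ke)) /=; last first.
  by rewrite -val_eqE /= gtn_eqF.
rewrite big1; last first.
  move=> l; rewrite -!val_eqE /= => /andP[lk lk1].
  by rewrite !mxE /= (negPf lk) (negPf lk1) mul0r.
rewrite !mxE /= eqxx gtn_eqF // eqxx addr0 IHk => /eqP; rewrite addrC addr_eq0 => /eqP E.
apply: (mulfI y_neq0); rewrite E -(subnSK lt_k) addnS !exprS; ring.
Qed.

Lemma det_band_withE v : y != 0 -> \det (band_with v) =
   \sum_(k < e) (-1) ^+ (e1 + k) * (x ^+ k * y ^+ (e1 - k)) * v 0 k.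
Proof.
by move=> y_neq0; rewrite det_band_with; apply: eq_bigr => k _;
  rewrite band_cofactorE // mulrC.
Qed.

Lemma ideal_gen_minors : y != 0 ->
  I `<=` ideal_gen (range (fun h : 'I_e -> 'I_(e1 + r.+1) => \det (rowsub h generators))).
Proof.
move=> y_neq0; set J := ideal_gen _; have idJ : ideal J by apply: ideal_gen_ideal.
apply: monomial_ideal_sub => // i ir.
pose i' : 'I_r.+1 := Ordinal (ir : (i < r.+1)%N).
pose h (l : 'I_e) : 'I_(e1 + r.+1) := if insub (l : nat) is Some j then lshift _ j else
  rshift _ i'.
have detE : \det (rowsub h generators) = (-1) ^+ (e1 + gen_col i) * (x ^+ a i * y ^+ b i).
  have -> : rowsub h generators = band_with (row i' gen_rows).
    apply/matrixP => l k; rewrite [LHS]mxE [RHS]mxE /h; case: insubP => [j _ _|_].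
      by rewrite col_mxEu.
    by rewrite col_mxEd [RHS]mxE.
  rewrite det_band_withE // (bigD1 (Ordinal (gen_col_le i : (gen_col i < e)%N))) //= big1.
    by rewrite addr0 !mxE /= eqxx -mulrA gen_entry_mul.
  by move=> k; rewrite -val_eqE /= => ki; rewrite !mxE /= (negPf ki) mulr0.
have -> : x ^+ a i * y ^+ b i = (-1) ^+ (e1 + gen_col i) * \det (rowsub h generators).
  by rewrite detE mulrA -expr2 sqrr_sign mul1r.
by apply: (idealMl idJ); apply: ideal_gen_sub; exists h.
Qed.

End Generators.

(** * Endomorphisms of the module *)

Section Idempotents.
Context {R : idomainType} (m : set R).
Hypothesis noethR : noetherian_ring R.
Hypothesis local : local_ring m.

(** The determinant of 1 - A is 1 modulo m, and A is killed by 1 - A. *)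
Lemma nilpotent_idempotent n (A : 'M[R]_n) : A *m A = A ->
  (forall i j : 'I_n, (j <= i)%N -> m (A i j)) -> A = 0.
Proof.
move=> AA mA; have idm := local_ideal local.
have det_unit : \det (1%:M - A) != 0.
  apply/eqP => d0; apply: (local_proper local).
  have := @det_sub1_cong _ m _ A^T idm; rewrite -[1%:M]trmx1 -linearB /= det_tr d0 subr0;
    apply.
  by move=> i j ij; rewrite mxE; apply: mA.
have A0 : (1%:M - A) *m A = 0 by rewrite mulmxBl mul1mx AA subrr.
apply/matrixP => i j; apply: (mulfI det_unit); rewrite [X in _ = _ * X]mxE mulr0.
have := congr1 (fun B => (\adj (1%:M - A) *m B) i j) A0.
by rewrite /= mulmxA mul_adj_mx mul_scalar_mx mulmx0 !mxE.
Qed.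

Lemma triangular_idempotent n (E : 'M[R]_n.+1) : E *m E = E ->
  (forall i j : 'I_n.+1, (j < i)%N -> m (E i j)) -> (forall i, m (E i i - E 0 0)) ->
  E = 0 \/ E = 1%:M.
Proof.
move=> EE low diag; have idm := local_ideal local.
have mE : m (E 0 0 * (1 - E 0 0)).
  have -> : E 0 0 * (1 - E 0 0) = \sum_(l | l != 0) E 0 l * E l 0.
    have := congr1 (fun B : 'M_n.+1 => B 0 0) EE; rewrite /= mxE (bigD1 0) //= => E00.
    by rewrite mulrBr mulr1 -[X in X - _]E00 addrAC subrr add0r.
  by apply: (ideal_sum idm) => l l0; apply: (idealMl idm); apply: low; rewrite lt0n.
have [mE0|mE1] := prime_idealM (local_prime noethR local) mE; [left|right].
  apply: nilpotent_idempotent => // i j; rewrite leq_eqVlt => /orP[/eqP ji|/low //].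
  have -> : j = i by apply: val_inj.
  by rewrite -[E i i](subrK (E 0 0)); apply: (idealD idm).
apply/eqP; rewrite eq_sym -subr_eq0; apply/eqP; apply: nilpotent_idempotent.
  by rewrite mulmxBl !mulmxBr !mul1mx mulmx1 EE subrr subr0.
move=> i j; rewrite !mxE leq_eqVlt => /orP[/eqP ji|ji].
  have -> : j = i by apply: val_inj.
  rewrite eqxx; have -> : 1 - E i i = (1 - E 0 0) - (E i i - E 0 0) by ring.
  exact: (idealB idm).
by rewrite -val_eqE /= gtn_eqF // sub0r; apply: (idealN idm); apply: low.
Qed.
End Idempotents.

Section Endomorphisms.
Context {R : idomainType} (m : set R) (x y : R).
Hypothesis noethR : noetherian_ring R.
Hypothesis local : local_ring m.
Hypothesis mxy : m = ideal_gen [set x; y].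
Hypothesis primex : prime_ideal (multiples x).
Hypothesis xNy : ~ multiples x y.
Hypothesis x0 : x != 0.
Variables (r e1 : nat) (a b : nat -> nat).
Local Notation e := e1.+1.
Local Notation I := (monomial_ideal x y r a b).
Hypothesis I_sub_deep : forall i, (i <= r)%N -> (e <= a i)%N || (e < a i + b i)%N.

Lemma monomial_ideal_sub_irreducible k : (k < e)%N ->
  I `<=` irreducible_ideal x y k.+1 (e - k).+1.
Proof.
move=> ke; apply: monomial_ideal_sub; first exact: irreducible_ideal_ideal.
move=> i ir; apply: irreducible_ideal_monomial; have := I_sub_deep ir; lia.
Qed.

(** For each k < e, the coefficient of x^k y^(e-k) in the determinant of the band
completed by (row j) E can be read modulo (x^(k+1), y^(e-k+1)), an ideal that
contains I and all the other monomials of degree e.  This coefficient is, up to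
sign, E_(j+1,k) - E_(j,k-1), or E_(j+1,0) when k = 0. *)
Lemma band_endomorphism (N : set 'rV[R]_e) (E : 'M[R]_e) :
  (forall A : 'M[R]_e, (forall i, N (row i A)) -> I (\det A)) ->
  (forall j, N (row j (band x y e1))) -> (forall u, N u -> N (u *m E)) ->
  (forall i j : 'I_e, (j < i)%N -> m (E i j)) /\ (forall i, m (E i i - E 0 0)).
Proof.
move=> detI Nband NE; have idm := local_ideal local; have y_neq0 := parameter_y_neq0 xNy.
(* the determinant is the sum of the x part F1 and the y part F2 of row j *)
pose F1 (j : 'I_e1) (k : 'I_e) := (-1) ^+ (e1 + k) * (x ^+ k.+1 * y ^+ (e1 - k)) * E
  (widen_ord (leqnSn e1) j) k.
pose F2 (j : 'I_e1) (k : 'I_e) := (-1) ^+ (e1 + k) * (x ^+ k * y ^+ (e - k)) * E (lift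
  ord0 j) k.
have rowE j k : (row j (band x y e1) *m E) 0 k =
    x * E (widen_ord (leqnSn e1) j) k + y * E (lift ord0 j) k.
  rewrite mxE (bigD1 (widen_ord (leqnSn e1) j)) //= (bigD1 (lift ord0 j)) /=; last first.
    by rewrite -val_eqE /= /bump add1n gtn_eqF.
  rewrite big1 ?addr0.
    by rewrite !mxE /= eqxx /bump add1n gtn_eqF // eqxx.
  move=> l; rewrite -!val_eqE /= /bump add1n => /andP[lj lj1].
  by rewrite !mxE (negPf lj) (negPf lj1) mul0r.
have I_sum j : I (\sum_k F1 j k + \sum_k F2 j k).
  have -> : \sum_k F1 j k + \sum_k F2 j k = \det (band_with x y (row j (band x y e1) *m E)).
    rewrite det_band_withE // -big_split /=; apply: eq_bigr => k _.
    have ke : (k <= e1)%N by rewrite -ltnS.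
    by rewrite rowE /F1 /F2 (subSn ke) [x ^+ k.+1]exprS [y ^+ _.+1]exprS; ring.
  apply: detI => i; have [ie|ei] := ltnP i e1.
    have -> : row i (band_with x y (row j (band x y e1) *m E)) = row (Ordinal ie) (band x
      y e1).
      by apply/rowP => k; rewrite mxE (@band_with_band _ x y e1 _ _ (Ordinal ie)) //
        [RHS]mxE.
    exact: Nband.
  have -> : i = ord_max by apply: val_inj => /=; have := ltn_ord i; lia.
  have -> : row ord_max (band_with x y (row j (band x y e1) *m E)) = row j (band x y e1)
    *m E.
    by apply/rowP => k; rewrite [LHS]mxE band_with_last.
  by apply: NE; apply: Nband.
have sgn_cancel n (c : R) : m ((-1) ^+ n * c) -> m c.
  by move=> /(idealMl idm ((-1) ^+ n)); rewrite mulrA -expr2 sqrr_sign mul1r.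
have extract j (k : 'I_e) : m (E (lift ord0 j) k - (if unlift ord0 k is Some k' then E
  (widen_ord (leqnSn e1) j) (widen_ord (leqnSn e1) k') else 0)).
  pose Q := irreducible_ideal x y k.+1 (e - k).+1.
  have idQ : ideal Q by apply: irreducible_ideal_ideal.
  have Qsum : Q (\sum_k F1 j k + \sum_k F2 j k)
    by apply: monomial_ideal_sub_irreducible (I_sum j).
  have QF2 : Q (\sum_k F2 j k - F2 j k).
    rewrite (bigD1 k) //= addrAC subrr add0r.
    apply: (ideal_sum idQ) => l lk; apply: (idealMr idQ); apply: (idealMl idQ).
    apply: irreducible_ideal_monomial; move: lk (ltn_ord l) (ltn_ord k);
      rewrite -val_eqE /=; lia.
  case: unliftP => [k' kE|k0]; last first.
    have QF1 : Q (\sum_k F1 j k).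
      apply: (ideal_sum idQ) => l _; apply: (idealMr idQ); apply: (idealMl idQ).
      by apply: irreducible_ideal_monomial; rewrite k0 /=; lia.
    have : Q (F2 j k).
      have -> : F2 j k = (\sum_k F1 j k + \sum_k F2 j k) - \sum_k F1 j k - (\sum_k F2 j k
        - F2 j k) by ring.
      by apply: (idealB idQ) => //; apply: (idealB idQ).
    rewrite /F2 mulrAC => /(monomial_coef local mxy primex xNy x0) /sgn_cancel.
    by rewrite subr0.
  pose kw := widen_ord (leqnSn e1) k'.
  have QF1 : Q (\sum_k F1 j k - F1 j kw).
    rewrite (bigD1 kw) //= addrAC subrr add0r.
    apply: (ideal_sum idQ) => l lk; apply: (idealMr idQ); apply: (idealMl idQ).
    apply: irreducible_ideal_monomial; move: lk (ltn_ord l) (ltn_ord k);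
      rewrite kE -val_eqE /= /bump add1n; lia.
  have : Q (F1 j kw + F2 j k).
    have -> : F1 j kw + F2 j k = (\sum_k F1 j k + \sum_k F2 j k)
        - (\sum_k F1 j k - F1 j kw) - (\sum_k F2 j k - F2 j k) by ring.
    by apply: (idealB idQ) => //; apply: (idealB idQ).
  have -> : F1 j kw + F2 j k = (-1) ^+ (e1 + k) *
      (E (lift ord0 j) k - E (widen_ord (leqnSn e1) j) kw) * (x ^+ k * y ^+ (e - k)).
    rewrite /F1 /F2 kE /= /bump add1n addnS [(-1) ^+ _.+1]exprS subSS; ring.
  by move=> /(monomial_coef local mxy primex xNy x0) /sgn_cancel.
have step (i i' j j' : 'I_e) : i = i'.+1 :> nat -> j = j'.+1 :> nat -> m (E i j - E i' j').
  move=> ii jj; have lt_i : (i' < e1)%N by have := ltn_ord i; lia.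
  have lt_j : (j' < e1)%N by have := ltn_ord j; lia.
  have := extract (Ordinal lt_i) (lift ord0 (Ordinal lt_j)); rewrite liftK.
  by congr (m (E _ _ - E _ _)); apply: val_inj; rewrite /= ?ii ?jj.
split.
  move=> [i ie] [j je] /= ji; elim: j i ie je ji => [|j IHj] [//|i] ie je ji.
    have := extract (Ordinal (ie : (i < e1)%N)) ord0; rewrite unlift_none subr0.
    by congr (m (E _ _)); apply: val_inj.
  rewrite -[E _ _](subrK (E (Ordinal (ltnW ie)) (Ordinal (ltnW je)))).
  by apply: (idealD idm); [apply: step|apply: IHj].
move=> [i ie]; elim: i ie => [|i IHi] ie.
  have -> : Ordinal ie = 0 by apply: val_inj.
  by rewrite subrr; apply: (ideal0 idm).
rewrite -[E _ _](subrK (E (Ordinal (ltnW ie)) (Ordinal (ltnW ie)))) -addrA.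
by apply: (idealD idm); [apply: step|apply: IHi].
Qed.
End Endomorphisms.

Theorem theorem1p4 (R : idomainType) (m : set R) (x y : R)
    (r e : nat) (a b : nat -> nat) (I : set R)
    (R_regular : regular_local_ring m 2)
    (residue_infinite : infinite_set [set: residue m])
    (xy_parameters : m = ideal_gen [set x; y])
    (I_monomial : I = ideal_gen
       [set x ^+ a i * y ^+ b i | i in [set i : nat | (i <= r)%N]])
    (I_primary : primary_ideal I) (I_radical : radical I = m)
    (I_complete : complete_ideal I)
    (a_decreasing : forall i, (i < r)%N -> (a i.+1 < a i)%N)
    (a_last : a r = 0%N)
    (b_first : b 0%N = 0%N)
    (b_increasing : forall i, (i < r)%N -> (b i < b i.+1)%N)
    (a_le_b : (a 0%N <= b r)%N)
    (e_bounds : (2 <= e <= r)%N)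
    (a_e : a (r - e + 2)%N = (e - 2)%N)
    (cases : (e + 1 <= r)%N \/
       [/\ r = e, ~ I (x ^+ (r - 1) * y) & I (x ^+ r)]) :
  exists M : lmodType R,
    [/\ finitely_generated M, torsion_free M, indecomposable M,
        integrally_closed M & has_rank M e /\ ideal_of_module M = I].
Proof.
have [noethR local dim2 _] := R_regular.
have primex := multiples_x_prime noethR local xy_parameters dim2.
have xNy : ~ multiples x y.
  by have := y_not_nilpotent_mod_x noethR local xy_parameters (n := 1) dim2; rewrite expr1.
have x0 : x != 0.
  have yx : m = ideal_gen [set y; x] by rewrite setUC.
  have := y_not_nilpotent_mod_x noethR local yx (n := 1) dim2; rewrite expr1 => yNx.
  by apply/eqP => x0; apply: yNx; rewrite x0; apply: ideal0 (multiples_ideal _).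
have y_neq0 := parameter_y_neq0 xNy.
change (I = monomial_ideal x y r a b) in I_monomial.
case: e e_bounds a_e cases => [//|e1] /andP[e1_gt0 e_le_r] a_e cases.
rewrite ltnS in e1_gt0.
have idI : ideal I by rewrite I_monomial; apply: monomial_ideal_ideal.
pose G := generators x y r e1 a b.
have normalR := fraction_in_all_dvr noethR local xy_parameters primex xNy x0.
have r_gt0 : (0 < r)%N by apply: leq_trans e_le_r.
have critI := valuative_criterion noethR local xy_parameters primex xNy x0 r_gt0 a_last
  b_first
  a_decreasing b_increasing.
rewrite -I_monomial in critI; have {}critI := critI I_complete.
have minorI : forall f, I (\det (rowsub f G)).
  by move=> f; rewrite I_monomial; apply: generators_minor.
have I_minor : I `<=` ideal_gen (range (fun f : 'I_e1.+1 -> _ => \det (rowsub f G))).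
  by rewrite I_monomial; apply: ideal_gen_minors.
have detN := closure_rows_det critI minorI.
have genN := closure_rows_det_gen I_minor.
have Ix : I (x ^+ a 0).
  by rewrite I_monomial; apply: ideal_gen_sub; exists 0%N => //;
    rewrite b_first expr0 mulr1.
have Iy : I (y ^+ b r).
  by rewrite I_monomial; apply: ideal_gen_sub; exists r => //=; rewrite a_last expr0 mul1r.
have Nx i := closure_rows_scale I_minor i Ix.
have Ny i := closure_rows_scale I_minor i Iy.
have xa0 : x ^+ a 0 != 0 by apply: expf_neq0.
have coprime_xy p q : y ^+ b r * p = x ^+ a 0 * q -> multiples (x ^+ a 0) p.
  by move=> E; apply: (multiples_exp_coprime primex xNy x0 (t := b r)); exists q;
    rewrite E mulrC.
have I_sub_deep i : (i <= r)%N -> (e1.+1 <= a i)%N || (e1.+1 < a i + b i)%N.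
  move=> ir; have ai := decreasing_ge a_decreasing ir; have bi :=
    increasing_ge b_increasing ir.
  case: cases => [|[re nI Ixr]]; first lia.
  have a0r : (a 0 <= r)%N.
    move: Ixr; rewrite I_monomial -[x ^+ r]mulr1 -(expr0 y) -[_ * _]mul1r.
    move=> /(monomial_ideal_unit local xy_parameters primex xNy x0 (unitr1 _))[j [jr aj
      bj]].
    have := increasing_ge b_increasing jr; case: j jr aj bj => [//|j] *; lia.
  (* if r = e then a_0 = e, while b_i > i for i > 0 since x^(r-1) y is not in I *)
  have b1 : (1 < b 1)%N.
    rewrite ltnNge; apply/negP => b1; apply: nI; rewrite I_monomial -[y in _ * y]expr1.
    apply: (@monomial_ideal_mem _ x y r a b 1) => //; have := a_decreasing 0%N; lia.
  have [->|i_gt0] := posnP i; first by have := decreasing_ge a_decreasing (leq0n r); lia.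
  suff : (i < b i)%N by lia.
  elim: i i_gt0 ir {ai bi} => // -[//|i] IHi _ ir.
  by apply: leq_ltn_trans (b_increasing i.+1 ir); apply: IHi => //; apply: ltnW.
exists (submod_type (closure_rows_submodule G)); split.
- exact: submod_type_fg.
- move=> c u cu0; have [->|c0] := eqVneq c 0; [by left|right].
  have cu : c *: submod_val u = 0.
    exact: (congr1 (@submod_val _ _ _ (closure_rows_submodule G)) cu0).
  apply: submod_val_inj; apply/rowP => i; apply: (mulfI c0).
  by have := congr1 (fun w : 'rV[R]_e1.+1 => w 0 i) cu; rewrite !mxE mulr0.
- apply: (submod_indecomposable (closure_rows_submodule G) xa0 Nx Ny coprime_xy) => // E
  EE NE.
  have [||low diag] := @band_endomorphism _ _ _ _ local xy_parameters primex xNy x0 r e1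
    a b I_sub_deep _ E _ _ NE.
  + by rewrite -I_monomial.
  + move=> j; have -> : row j (band x y e1) = row (lshift _ j) G
    by rewrite /G /generators rowKu.
    exact: closure_rows_row.
  exact: (triangular_idempotent noethR local EE low diag).
- exact: closure_rows_integrally_closed normalR.
split.
  apply: (has_rank_of_coord (iota := @submod_val _ _ _ (closure_rows_submodule G)) _ _ xa0).
  - by [].
  - exact: submod_val_inj.
  - by move=> i; exists (mk_submod _ (Nx i)).
exact: (ideal_of_submod (closure_rows_submodule G) xa0 Nx Ny coprime_xy idI detN genN).
Qed.
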